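(* Let $\alpha\in(0,1)$ be an irrational number of bounded type, and let $\varphi_{1/2}(x)=1_{[0,1/2]}(x)-\tfrac12$ on $\mathbb{T}^1$. Consider the map $$T_{\alpha,\varphi_{1/2}}:(x,y)\mapsto(x+\alpha \bmod 1,\ y+\varphi_{1/2}(x))$$ acting on $\mathbb{T}^1\times\tfrac12\mathbb{Z}$. Then the centralizer of $T_{\alpha,\varphi_{1/2}}$ is the group generated by the translations on the fibers $(x,y)\mapsto(x,y+\lambda)$, $\lambda\in\tfrac12\mathbb{Z}$ constant, the map $(x,y)\mapsto(x+\tfrac12 \bmod 1,\,-y)$, and the powers of $T_{\alpha,\varphi_{1/2}}$.
   Context: $\mathbb{T}^1=\mathbb{R}/\mathbb{Z}$ with Lebesgue measure $\mu$. An irrational $\alpha=[0;a_1,a_2,\dots]$ is of bounded type if its sequence of partial quotients $(a_n)$ is bounded. The centralizer of a cylinder map $\tilde T$ on $(\mathbb{T}^1\times G,\mu\times m_G)$ (here $G=\tfrac12\mathbb{Z}$ with counting measure $m_G$) is the group of all measure preserving automorphisms of $(\mathbb{T}^1\times G,\mu\times m_G)$ which commute with $\tilde T$; maps are identified when they agree almost everywhere. *)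

(* Defs.v *)
From HB Require Import structures.
From mathcomp Require Import all_boot all_order all_algebra ring_quotient.
From mathcomp Require Import all_classical all_reals all_analysis.

Set Implicit Arguments.
Unset Strict Implicit.
Unset Printing Implicit Defensive.

Import Order.TTheory GRing.Theory Num.Theory.
Import numFieldNormedType.Exports.

Local Open Scope classical_set_scope.
Local Open Scope ring_scope.
Local Open Scope quotient_scope.

Section continued_fraction.
Context {R : realType}.

Definition gauss_map (x : R) : R := x^-1 - (Num.floor x^-1)%:~R.

(* For an irrational x in (0, 1) with x = [0; a_1, a_2, ...], this is a_(n+1),
   because the n-th iterate of the Gauss map sends x to
   [0; a_(n+1), a_(n+2), ...]. *)
Definition partial_quotient (x : R) (n : nat) : int :=
  Num.floor (iter n gauss_map x)^-1.

Definition bounded_type (x : R) : Prop :=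
  irrational x /\ exists M : int, forall n, partial_quotient x n <= M.

End continued_fraction.

(* R/Z, as the quotient of the additive group of R by its subgroup Num.int;
   \pi_(circle R) is the projection, and + on circle R is addition mod 1. *)
Section circle.
Variable R : realType.

Definition int_subgroup : zmodClosed R :=
  GRing.ZmodClosed.clone R (@Num.int_num_subdef R) _.

Definition circle : Type := Quotient.quot int_subgroup.

HB.instance Definition _ := GRing.Zmodule.on circle.
HB.instance Definition _ := isPointed.Build circle 0.

Definition circle_proj (x : R) : circle := \pi_circle x.

(* The Borel sigma-algebra of R/Z is the one coinduced by the projection. *)
Definition circle_measurable : set (set circle) :=
  [set A | measurable (circle_proj @^-1` A)].

Let circle_measurable0 : circle_measurable set0.
Proof. by rewrite /circle_measurable /= preimage_set0. Qed.

Let circle_measurableC A : circle_measurable A -> circle_measurable (~` A).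
Proof. by rewrite /circle_measurable /= -preimage_setC; exact: measurableC. Qed.

Let circle_measurable_bigcup (F : (set circle)^nat) :
  (forall i, circle_measurable (F i)) -> circle_measurable (\bigcup_i F i).
Proof.
move=> mF; rewrite /circle_measurable /= preimage_bigcup.
exact: bigcupT_measurable.
Qed.

HB.instance Definition _ := @isMeasurable.Build default_measure_display circle
  circle_measurable circle_measurable0 circle_measurableC
  circle_measurable_bigcup.

(* The projection is a bijection from [0, 1[ onto R/Z. *)
Definition circle_measure (A : set circle) : \bar R :=
  @lebesgue_measure R (circle_proj @^-1` A `&` `[0, 1[%classic).

Let circle_measure0 : circle_measure set0 = 0%E.
Proof. by rewrite /circle_measure preimage_set0 set0I measure0. Qed.

Let circle_measure_ge0 A : (0 <= circle_measure A)%E.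
Proof. exact: measure_ge0. Qed.

Let circle_measure_sigma_additive : semi_sigma_additive circle_measure.
Proof.
move=> F mF tF mUF; rewrite /circle_measure preimage_bigcup setI_bigcupl.
apply: measure_semi_sigma_additive.
- by move=> n; apply: measurableI; [exact: (mF n)|exact: measurable_itv].
- apply/trivIsetP => i j _ _ ij; rewrite setIACA -preimage_setI.
  by move/trivIsetP : tF => /(_ _ _ _ _ ij) ->//; rewrite preimage_set0 set0I.
- by rewrite -setI_bigcupl -preimage_bigcup; apply: measurableI;
    [exact: mUF|exact: measurable_itv].
Qed.

HB.instance Definition _ := isMeasure.Build _ _ _ circle_measure
  circle_measure0 circle_measure_ge0 circle_measure_sigma_additive.

End circle.

Section half_integers.
Variable R : realType.

Definition half_int : {pred R} := fun y => 2 * y \is a Num.int.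

Lemma half_intE y : (y \in half_int) = (2 * y \is a Num.int).
Proof. by []. Qed.

Let half_int_zmod_closed : zmod_closed half_int.
Proof.
split=> [|x y]; rewrite !half_intE ?mulr0 ?rpred0// => hx hy.
by rewrite mulrBr rpredB.
Qed.

HB.instance Definition _ :=
  GRing.isZmodClosed.Build R half_int half_int_zmod_closed.

Record halfZ := HalfZ { halfZ_val :> R ; _ : halfZ_val \in half_int }.

HB.instance Definition _ := [isSub for halfZ_val].
HB.instance Definition _ := [Choice of halfZ by <:].
HB.instance Definition _ := [SubChoice_isSubZmodule of halfZ by <:].
HB.instance Definition _ := isPointed.Build halfZ 0.
HB.instance Definition _ := @isMeasurable.Build default_measure_display halfZ
  discrete_measurable discrete_measurable0
  discrete_measurableC discrete_measurableU.

Definition halfZ_counting : set halfZ -> \bar R := @counting halfZ R.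

HB.instance Definition _ := Measure.on halfZ_counting.

Let halfZ_counting_sigma_finite : sigma_finite setT halfZ_counting.
Proof.
pose f (y : halfZ) : nat := pickle (Num.floor (2 * (y : R))).
have f_inj : injective f.
  move=> x y /(pcan_inj (@pickleK int)) fxy; apply: val_inj => /=.
  have [hx hy] := (valP x, valP y).
  apply: (@mulfI _ (2 : R)); first by rewrite pnatr_eq0.
  by rewrite -[LHS](floorK hx) -[RHS](floorK hy); congr (_%:~R).
exists (fun n => f @^-1` `I_n.+1).
  by apply/seteqP; split=> // y _; exists (f y) => //=.
move=> n; split => //; rewrite /halfZ_counting /counting asboolT ?ltry//.
by apply: finite_preimage; [move=> x y _ _; exact: f_inj|exact: finite_II].
Qed.

HB.instance Definition _ :=
  Measure_isSigmaFinite.Build _ _ _ halfZ_counting halfZ_counting_sigma_finite.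

End half_integers.

(* Automorphisms are identified when they agree almost everywhere. Instead of
   quotienting, the sets of maps below contain, with an automorphism, every
   automorphism almost everywhere equal to it, so that they correspond
   bijectively to sets of classes; products are compositions and inverses are
   inverses up to null sets. *)
Section automorphisms.
Context d (X : measurableType d) (R : realType).
Variable mu : {measure set X -> \bar R}.
Implicit Types (S T : X -> X) (H G : set (X -> X)).

Definition measure_preserving S : Prop :=
  measurable_fun setT S /\
  forall A, measurable A -> pushforward mu S A = mu A.

Definition ae_inverse S S' : Prop :=
  (\forall x \ae mu, S (S' x) = x) /\ (\forall x \ae mu, S' (S x) = x).

Definition automorphism : set (X -> X) :=
  [set S | measure_preserving S /\
    exists2 S', measure_preserving S' & ae_inverse S S'].

Definition centralizer T : set (X -> X) :=
  [set S | automorphism S /\ \forall x \ae mu, S (T x) = T (S x)].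

Definition automorphism_group H : Prop :=
  [/\ H `<=` automorphism,
      H idfun,
      forall S S', H S -> H S' -> H (S \o S'),
      forall S S', H S -> automorphism S' -> ae_inverse S S' -> H S' &
      forall S S', H S -> automorphism S' ->
        (\forall x \ae mu, S x = S' x) -> H S'].

Definition generated_group G : set (X -> X) := smallest automorphism_group G.

(* Powers with an arbitrary integer exponent: the second disjunct covers the
   negative ones. *)
Definition powers T : set (X -> X) :=
  [set S | automorphism S /\ exists n,
    (\forall x \ae mu, S x = iter n T x) \/ ae_inverse S (iter n T)].

End automorphisms.

Notation cylinder R := (circle R * halfZ R)%type.

Section cylinder.
Variable R : realType.

Definition cylinder_measure : {measure set (cylinder R) -> \bar R} :=
  (@circle_measure R \x @halfZ_counting R)%E.

Definition cylinder_map (alpha : R) (phi : circle R -> halfZ R)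
    (z : cylinder R) : cylinder R :=
  (z.1 + circle_proj alpha, z.2 + phi z.1).

Let phi_half_val (x : circle R) : R :=
  \1_(@circle_proj R @` `[0, 2^-1]%classic) x - 2^-1.

Let phi_half_subproof x : phi_half_val x \in @half_int R.
Proof.
rewrite half_intE /phi_half_val mulrBr mulfV ?pnatr_eq0//.
by rewrite indicE -natrM rpredB ?rpred1// rpred_nat.
Qed.

Definition phi_half (x : circle R) : halfZ R := HalfZ (phi_half_subproof x).

Definition fiber_translation (l : halfZ R) (z : cylinder R) : cylinder R :=
  (z.1, z.2 + l).

Definition half_turn_flip (z : cylinder R) : cylinder R :=
  (z.1 + circle_proj 2^-1, - z.2).

End cylinder.

(* Main.v *)
Require Import Defs.
From HB Require Import structures.
From mathcomp Require Import all_boot all_order all_algebra.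
From mathcomp Require Import all_classical all_reals all_analysis.
From mathcomp Require Import measurable_realfun.
From mathcomp Require Import zify ring lra.

Import Order.TTheory GRing.Theory Num.Theory.
Import numFieldNormedType.Exports.
Local Open Scope classical_set_scope.
Local Open Scope ring_scope.

Set Implicit Arguments.
Unset Strict Implicit.
Unset Printing Implicit Defensive.

(** Let phi be the function 1_[0,1/2] - 1/2, read as a 1-periodic function on
    the line, and let S_N f x be the sum of f (x + k alpha) over k < N.

    Reduction to cohomology. The map T is ergodic (cylinder_ergodic). If S
    commutes with T then the base coordinate of S z, minus that of z, is
    T-invariant, hence constant; and for each height h the difference of the
    fiber coordinates of S (x, y + h) and S (x, y) is T-invariant, hence a
    constant, additive in h. So S (x, y) = (x + beta, psi x + e y) with e an
    integer, and e is 1 or -1 because S has an inverse of the same form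
    (centralizer_form). Commutation now says that
      psi (x + alpha) - psi x = phi (x + beta) - e phi x,
    that is, that the right-hand side is a coboundary.

    Bounded type. It is used only through c <= k |k alpha - n|, which makes the
    first N points of an orbit spread evenly at scale 1/N: they are c/N apart
    and meet every interval of length comparable to 1/N. Since phi jumps by 1
    or -1 at the half-integers and nowhere else, S_N phi is near every point a
    step function whose consecutive jumps are at distance at least a constant
    times 1/N.

    Rigidity at density points. Choose N with |N alpha - m| of order 1/N. If
    psi (x + alpha) - psi x = f x and x0 is a density point of the level set
    of psi through x0, then x and x + N alpha - m both lie in that level set
    for most x at distance of order 1/N from x0, so S_N f = 0 there. Hence
    S_N f has no jump that is isolated at scale 1/N near x0
    (coboundary_no_isolated_jump). For f x = phi (x + beta) - e phi x, every
    jump of S_N phi near x0 must therefore be compensated by a jump of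
    S_N phi (. + beta), which makes 2 l alpha + 2 beta very close to an integer
    with |l| <= N. Letting N vary over comparable scales, bad approximability
    forces l not to depend on N, so that 2 l alpha + 2 beta is an integer
    (phi_translate_coboundary). For f = phi + phi there is nothing to
    compensate the jumps, and f is not a coboundary at all
    (double_phi_not_coboundary).

    The same idea proves ergodicity. Given an invariant set, let Y be the set
    of heights above a typical x0 that belong to it. If S_N phi takes the value
    v on an interval of length of order 1/N near x0, then Y is invariant under
    translation by v; on the two sides of a jump v differs by 1, so Y is
    invariant under translation by 1. What remains is the rotation by
    2 alpha on the circle, handled by density points as well. This requires
    the values v to stay bounded along the chosen N, so that finitely many
    sections of the invariant set matter. The times N = 2 j with j alpha close
    to 1/2 do it, because phi (x + 1/2) = - phi x makes S_j phi x and
    S_j phi (x + j alpha) cancel up to a bounded number of jumps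
    (return_times).

    Conclusion. Composing S with a power of T, and with the half-turn flip if
    necessary, makes beta = 0. The sign e is then 1, since phi + phi is not a
    coboundary, and psi is invariant under the rotation, hence constant: what
    is left of S is a translation on the fibers. *)

(** * Bounded type implies bad approximability *)

Section badly_approximable.
Variable R : realType.
Implicit Types (x t : R) (p q : int) (k : nat).

Definition badly_approximable (c x : R) : Prop :=
  forall k (n : int), (0 < k)%N -> c <= k%:R * `|k%:R * x - n%:~R|.

Let quotients_le (M : int) x : Prop :=
  [/\ irrational x, 0 < x < 1 & forall n, partial_quotient x n <= M].

Let gauss_map_irrational x : irrational x -> irrational (gauss_map x).
Proof.
move=> xirr [r _ rE]; apply: xirr; exists (r + (Num.floor x^-1)%:~R)^-1 => //.
by rewrite fmorphV rmorphD /= ratr_int rE /gauss_map subrK invrK.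
Qed.

Let irrational_neq0 x : irrational x -> x != 0.
Proof. by move=> xirr; apply/eqP => x0; apply: xirr; exists 0; rewrite ?rmorph0. Qed.

Let gauss_map_quotients (M : int) x :
  quotients_le M x -> quotients_le M (gauss_map x).
Proof.
move=> [xirr /andP[x0 x1] xM]; split.
- exact: gauss_map_irrational.
- rewrite /gauss_map; have /andP[f1 f2] := floor_itv x^-1.
  have := irrational_neq0 (gauss_map_irrational xirr); rewrite /gauss_map => ne.
  rewrite lt_neqAle eq_sym ne subr_ge0 f1/=.
  by rewrite ltrBlDl -intrD1.
- by move=> n; have := xM n.+1; rewrite /partial_quotient iterSr.
Qed.

(** With x = 1 / (a + y), t' = a + 1 / t and (p', q') = (q - p a, p), the quantity
    |p - q x| (p + q t) / (x + t) takes the same value at (x, t, p, q) and at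
    (y, t', p', q'): it is the absolute value of an indefinite binary quadratic
    form with roots x and - t, divided by the square root of its discriminant.
    Descending along the Gauss map reaches p = 0 or p' < 0, where the bound is immediate. The
    parameter m only bounds p + q, which decreases. *)
Let quadratic_form_lower_bound (M : int) (m : nat) x t p q :
  quotients_le M x -> 1 <= t <= M%:~R + 1 -> 0 <= p -> 1 <= q ->
  p + q <= m%:Z ->
  (2 * (M%:~R + 1))^-1 * (x + t) <= `|p%:~R - q%:~R * x| * (p%:~R + q%:~R * t).
Proof.
elim: m x t p q => [|m IH] x t p q Xx /andP[t1 tM] p0 q1 pqm; first lia.
have Xy := gauss_map_quotients Xx.
case: (Xx) => xirr /andP[x0 x1] xM.
set a := Num.floor x^-1.
have aM : a <= M := xM 0%N.
set y := gauss_map x in Xy.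
have [_ /andP[y0 y1] _] := Xy.
have xE : x^-1 = a%:~R + y by rewrite /y /gauss_map -/a addrC subrK.
clearbody a y.
have xM1 : x * (a%:~R + y) = 1 by rewrite -xE mulfV ?gt_eqF.
have a1 : 1 <= a.
  suff : (0 : R) < a%:~R by rewrite ltr0z gtz0_ge1.
  have := invf_gt1 x0; rewrite x1 xE => h; lra.
have M1 : (1 : R) <= M%:~R by rewrite ler1z; lia.
have aMR : a%:~R <= M%:~R :> R by rewrite ler_int.
have a1R : 1 <= a%:~R :> R by rewrite ler1z.
have Mx : 1 <= x * (M%:~R + 1).
  by rewrite -[leLHS]xM1 ler_pM2l//; lra.
have q1R : 1 <= q%:~R :> R by rewrite ler1z.
have p0R : 0 <= p%:~R :> R by rewrite ler0z.
have M0 : 0 < 2 * (M%:~R + 1) :> R by lra.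
rewrite ler_pdivrMl//.
have qx0 : 0 < q%:~R * x by rewrite mulr_gt0//; lra.
have [pz|pnz] := eqVneq p 0.
  rewrite pz sub0r normrN ger0_norm ?ltW// add0r.
  have : x * t <= q%:~R * x * (q%:~R * t).
    have : 1 <= q%:~R * q%:~R :> R by nra.
    have : 0 < x * t by nra.
    nra.
  move=> /(ler_wpM2l (ltW M0)).
  have : t <= x * (M%:~R + 1) * t by nra.
  lra.
have p1 : 1 <= p by clear - p0 pnz; lia.
have p1R : 1 <= p%:~R :> R by rewrite ler1z.
(* One step of the Euclidean algorithm, unless p / q exceeds 1 / a. *)
have [q'0|q'0] := leP 0 (q - p * a).
  have t' : 1 <= a%:~R + t^-1 <= M%:~R + 1.
    have : 0 < t^-1 <= 1 by rewrite invr_gt0 invf_le1//; lra.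
    lra.
  have := IH y (a%:~R + t^-1) (q - p * a) p Xy t' q'0 p1.
  have -> // : q - p * a + p <= m by clear - p1 a1 pqm; nia.
  move=> /(_ isT); rewrite ler_pdivrMl//.
  rewrite rmorphB rmorphM/=.
  have -> : p%:~R - q%:~R * x = x * (p%:~R * y - (q%:~R - p%:~R * a%:~R)).
    transitivity (p%:~R * (x * (a%:~R + y)) - q%:~R * x); last by ring.
    by rewrite xM1 mulr1.
  have -> : y + (a%:~R + t^-1) = (x + t) / (x * t).
    have -> : y = x^-1 - a%:~R by rewrite xE addrAC subrr add0r.
    by field; rewrite !gt_eqF//; lra.
  have -> : q%:~R - p%:~R * a%:~R + p%:~R * (a%:~R + t^-1) =
      (p%:~R + q%:~R * t) / t.
    by field; rewrite gt_eqF//; lra.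
  rewrite normrM (gtr0_norm x0) distrC.
  set u := `|_|; set v := p%:~R + _; rewrite ler_pdivrMr; last by nra.
  have -> // : 2 * (M%:~R + 1) * (u * (v / t)) * (x * t) =
    2 * (M%:~R + 1) * (x * u * v).
  by field; rewrite gt_eqF//; lra.
have q'1 : q%:~R + 1 <= p%:~R * a%:~R :> R.
  by rewrite -intrM -[1]/(1%:~R) -intrD ler_int; clear - q'0; lia.
have px : x <= p%:~R - q%:~R * x.
  have -> : p%:~R = p%:~R * (x * (a%:~R + y)) by rewrite xM1 mulr1.
  have : x * (q%:~R + 1) <= x * (p%:~R * a%:~R) by rewrite ler_pM2l.
  have : 0 < p%:~R * (x * y) by rewrite mulr_gt0//; nra.
  lra.
rewrite ger0_norm; last by lra.
have : x + t <= p%:~R + q%:~R * t by nra.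
set u := p%:~R - _ in px *; set v := p%:~R + _; move=> xv.
have : 1 <= (M%:~R + 1) * u by nra.
have v0 : 0 < v by nra.
move=> /(ler_wpM2r (ltW v0)); lra.
Qed.

Lemma bounded_type_badly_approximable x : 0 < x < 1 -> bounded_type x ->
  exists2 c, 0 < c & badly_approximable c x.
Proof.
move=> x01 [xirr [M xM]].
have Xx : quotients_le M x by [].
have M1 : (1 : R) <= M%:~R.
  rewrite ler1z (le_trans _ (xM 0%N))// /partial_quotient/=.
  have := floor_itv x^-1; move/andP: x01 => [x0 x1].
  have : 1 < x^-1 by rewrite invf_gt1.
  move=> h /andP[_ h']; suff : (0 : R) < (Num.floor x^-1)%:~R by rewrite ltr0z gtz0_ge1.
  by move: h'; rewrite intrD; lra.
(* The form is used with t = 1, where p + q t <= 2 q if p <= q. *)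
exists (4 * (M%:~R + 1))^-1 => [|k n k0].
  by rewrite invr_gt0; lra.
have k1 : (1 : R) <= k%:R by rewrite ler1n.
set c := _^-1.
have c1 : 0 < c <= 1 by rewrite invr_gt0 invf_le1; lra.
move/andP: (x01) => [x0 x1].
have kx : k%:R * x <= k%:R by nra.
have kx0 : 0 <= k%:R * x by nra.
have [n0|n0] := ltP n 0.
  have : n%:~R <= -1 :> R by rewrite -[-1]/((-1)%:~R) ler_int; clear - n0; lia.
  move=> ?; rewrite ger0_norm; last lra.
  have : 1 <= k%:R * x - n%:~R by lra.
  nra.
have [nk|nk] := leP n k.
  have kn : n + k%:Z <= (absz (n + k%:Z))%:Z by clear - n0; lia.
  have kz : 1 <= k%:Z by clear - k0; lia.
  have t1 : 1 <= (1 : R) <= M%:~R + 1 by lra.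
  have := quadratic_form_lower_bound Xx t1 n0 kz kn.
  rewrite mulr1 -pmulrn distrC.
  have : n%:~R <= k%:R :> R by rewrite pmulrn ler_int.
  set u := `|_|.
  have -> : (2 * (M%:~R + 1))^-1 = 2 * c.
    by rewrite /c; field; rewrite gt_eqF//; lra.
  have : 0 <= u by exact: normr_ge0.
  nra.
have : k%:R + 1 <= n%:~R :> R by rewrite pmulrn -[1]/(1%:~R) -intrD ler_int; clear - nk; lia.
move=> ?; rewrite distrC ger0_norm; last lra.
have : 1 <= n%:~R - k%:R * x by lra.
nra.
Qed.

End badly_approximable.


(** * Distribution of the orbits of the rotation *)

Section rotation_orbits.
Variables (R : realType).
Implicit Types (x y z : R) (k n N Q : nat) (m p : int).

(** Two of the Q + 1 fractional parts of i x, for i <= Q, fall in the same of the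
    Q intervals of length 1 / Q. *)
Lemma dirichlet_approximation x Q : (0 < Q)%N ->
  exists q p, [/\ (0 < q)%N, (q <= Q)%N & `|q%:R * x - p%:~R| * Q%:R < 1].
Proof.
case: Q => // Q _; pose Q1 := Q.+1.
have Q0 : (0 : R) < Q1%:R by rewrite ltr0n.
pose fr i : R := i%:R * x - (Num.floor (i%:R * x))%:~R.
have fr01 i : 0 <= fr i < 1.
  by rewrite /fr subr_ge0 ltrBlDl -intrD1 floor_itv.
have g_ge0 i : 0 <= Num.floor (Q1%:R * fr i).
  by rewrite floor_ge0 mulr_ge0// ?(ltW Q0)//; case/andP: (fr01 i).
pose g (i : 'I_Q1.+1) : nat := absz (Num.floor (Q1%:R * fr i)).
have gE i : (g i)%:Z = Num.floor (Q1%:R * fr i) by rewrite /g gez0_abs.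
have g_lt i : (g i < Q1)%N.
  rewrite -ltz_nat gE -(ltr_int R); apply: (le_lt_trans (floor_le _)).
  by rewrite -pmulrn gtr_pMr//; case/andP: (fr01 i).
pose f i : 'I_Q1 := Ordinal (g_lt i).
have f_ninj : ~ injective f.
  by move=> /leq_card; rewrite !card_ord ltnn.
apply: contrapT => nex; apply: f_ninj => i j fij; apply/val_inj/eqP => /=.
have gij : g i = g j by case: fij.
have close : `|fr i - fr j| * Q1%:R < 1.
  have := floor_itv (Q1%:R * fr i); have := floor_itv (Q1%:R * fr j).
  rewrite -!gE gij intrD -pmulrn => /andP[h1 h2] /andP[h3 h4].
  rewrite -[X in _ * X < _](gtr0_norm Q0) -normrM ltr_norml; lra.
rewrite eqn_leq; apply/andP; split; rewrite leqNgt; apply/negP => ij.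
  apply: nex; exists (i - j)%N, (Num.floor (i%:R * x) - Num.floor (j%:R * x)).
  split; [by rewrite subn_gt0|by rewrite (leq_trans (leq_subr _ _))// -ltnS ltn_ord|].
  rewrite (natrB _ (ltnW ij)) intrB.
  have -> // : (i%:R - j%:R) * x - ((Num.floor (i%:R * x))%:~R - (Num.floor (j%:R * x))%:~R)
    = fr i - fr j.
  by rewrite /fr; move: (_%:~R) (_%:~R) => s t; ring.
apply: nex; exists (j - i)%N, (Num.floor (j%:R * x) - Num.floor (i%:R * x)).
split; [by rewrite subn_gt0|by rewrite (leq_trans (leq_subr _ _))// -ltnS ltn_ord|].
rewrite (natrB _ (ltnW ij)) intrB.
have -> // : (j%:R - i%:R) * x - ((Num.floor (j%:R * x))%:~R - (Num.floor (i%:R * x))%:~R)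
  = fr j - fr i.
  by rewrite /fr; move: (_%:~R) (_%:~R) => s t; ring.
by rewrite distrC.
Qed.

(** Dividing p and q by their gcd d divides |q x - p| by d, so the approximation
    can be taken in lowest terms. *)
Lemma dirichlet_approximation_coprime x Q : (0 < Q)%N ->
  exists q p, [/\ (0 < q)%N, (q <= Q)%N, `|q%:R * x - p%:~R| * Q%:R < 1 &
    exists u v, u * p + v * q%:Z = 1].
Proof.
move=> Q0; have [q [p [q0 qQ qp]]] := dirichlet_approximation x Q0.
have [u [v uv]] := Bezoutz p q.
set d := gcdz p q in uv.
have d0 : 0 < d by rewrite /d /gcdz ltz_nat gcdn_gt0 absz_nat q0 orbT.
have dp : p = (p %/ d)%Z * d by rewrite divzK// dvdz_gcdl.
have dq : q%:Z = (q %/ d)%Z * d by rewrite divzK// dvdz_gcdr.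
set p' := (p %/ d)%Z in dp; set q' := (q %/ d)%Z in dq.
have q'0 : 0 < q' by clear - dq d0 q0; nia.
have q'E : (absz q')%:Z = q' by rewrite gez0_abs// ltW.
exists (absz q'), p'; split.
- by clear - q'0; lia.
- by clear - q'0 dq d0 qQ; nia.
- apply: le_lt_trans qp; rewrite ler_wpM2r//.
  have -> : (absz q')%:R = q'%:~R :> R by rewrite -[in RHS]q'E -pmulrn.
  have -> : q%:R = q'%:~R * d%:~R :> R by rewrite -intrM -dq -pmulrn.
  rewrite dp intrM.
  have -> : q'%:~R * d%:~R * x - p'%:~R * d%:~R = d%:~R * (q'%:~R * x - p'%:~R) by ring.
  rewrite normrM ler_peMl// ger0_norm; first by rewrite ler1z; clear -d0; lia.
  by rewrite ler0z ltW.
- exists u, v; rewrite q'E.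
  apply: (mulIf (lt0r_neq0 d0)); rewrite mul1r -[RHS]uv [in RHS]dp [in RHS]dq; ring.
Qed.

Variables (c alpha : R).
Hypotheses (c0 : 0 < c) (alphaP : badly_approximable c alpha).

Lemma badly_approximable_le1 : c <= 1.
Proof.
have := alphaP (Num.floor alpha) (ltn0Sn 0); rewrite !mul1r => /le_trans; apply.
have := floor_itv alpha; rewrite intrD => h; rewrite ger0_norm; lra.
Qed.

(** The first q points of the orbit are close to those of the rotation by p / q,
    which are equally spaced when p and q are coprime. Bad approximability
    excludes that q be much smaller than N. *)
Lemma orbit_dense N z : (0 < N)%N ->
  exists k m, (k < N)%N /\ `|z + k%:R * alpha - m%:~R| <= 2 / c / N%:R.
Proof.
move=> N0; have [q [p [q0 qN qp [u [v uv]]]]] := dirichlet_approximation_coprime alpha N0.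
have N0R : (0 : R) < N%:R by rewrite ltr0n.
have q0R : (0 : R) < q%:R by rewrite ltr0n.
have qNR : (q%:R : R) <= N%:R by rewrite ler_nat.
have cNq : c * N%:R <= q%:R.
  have := alphaP p q0; nra.
(* - z is just above i / q; the time j at which j p / q = i / q mod 1 comes from
   the Bezout coefficient u. *)
set i := Num.floor (- (q%:R * z)).
have /andP[i1 i2] := floor_itv (- (q%:R * z)).
rewrite -/i intrD in i1 i2.
have q0z : q%:Z != 0 by clear - q0; lia.
set j := (i * u %% q)%Z.
have j0 : 0 <= j by rewrite modz_ge0.
have jq : j < q by rewrite ltz_pmod//; clear - q0; lia.
have jE := divz_eq (i * u) q.
rewrite -/j in jE.
set w := (_ %/ _)%Z in jE.
exists (absz j), (- (i * v + w * p)); split.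
  by apply: leq_trans qN; clear - j0 jq; lia.
have -> : (absz j)%:R = j%:~R :> R by rewrite -[in RHS](gez0_abs j0) -pmulrn.
have mE : j * p - i = q%:Z * (- (i * v + w * p)).
  have -> : j = i * u - w * q%:Z by rewrite jE; ring.
  transitivity (i * (u * p + v * q%:Z - 1) - q%:Z * (i * v + w * p)); first by ring.
  by rewrite uv; ring.
have {}mE : j%:~R * p%:~R - i%:~R = q%:R * (- (i * v + w * p))%:~R :> R.
  by rewrite pmulrn -!intrM -mE rmorphB.
set m := (- (_))%:~R in mE *.
have j0R : (0 : R) <= j%:~R by rewrite ler0z.
have jqR : j%:~R < q%:R :> R by rewrite pmulrn ltr_int.
have N1 : N%:R^-1 <= q%:R^-1 :> R by rewrite lef_pV2.
have q1 : q%:R^-1 <= c^-1 / N%:R.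
  rewrite -invfM lef_pV2 ?posrE// mulr_gt0//.
have -> : 2 / c / N%:R = 2 * (c^-1 / N%:R) by rewrite mulrA.
apply: (@le_trans _ _ (2 * q%:R^-1)); last by rewrite ler_pM2l.
rewrite ler_pdivlMr// -[X in _ * X <= _](gtr0_norm q0R) -normrM.
have -> : (z + j%:~R * alpha - m) * q%:R =
  (q%:R * z + i%:~R) + j%:~R * (q%:R * alpha - p%:~R) + (j%:~R * p%:~R - i%:~R - q%:R * m).
  by ring.
rewrite mE subrr addr0 (le_trans (ler_normD _ _))//.
have : `|q%:R * z + i%:~R| <= 1 by rewrite ler_norml; lra.
have : `|j%:~R * (q%:R * alpha - p%:~R)| <= 1.
  rewrite normrM (ger0_norm j0R); set s := `|_| in qp *.
  have : 0 <= s by exact: normr_ge0.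
  nra.
lra.
Qed.

End rotation_orbits.


(** * The step function on the line *)

Section half_integers.
Variable R : realType.
Implicit Types (x y : R) (m k : int).

Lemma int_parity m : exists h, m = 2 * h \/ m = 2 * h + 1.
Proof.
exists (m %/ 2)%Z; have := divz_eq m 2.
have := @ltz_pmod m 2 isT; have := @modz_ge0 m 2 isT; lia.
Qed.

Lemma circle_projP x y : (circle_proj x = circle_proj y) <-> (x - y \is a Num.int).
Proof.
rewrite /circle_proj; split => [/eqP|] h.
  by move: h; rewrite eqmodE.
by apply/eqP; rewrite eqmodE.
Qed.

Lemma circle_projD x y : circle_proj (x + y) = circle_proj x + circle_proj y.
Proof. by rewrite /circle_proj !piE. Qed.

Lemma halfz_subproof k : (k%:~R / 2 : R) \in @half_int R.
Proof. by rewrite half_intE mulrC divfK ?pnatr_eq0// intr_int. Qed.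

Definition halfz k : halfZ R := HalfZ (halfz_subproof k).

Lemma halfz_surj (y : halfZ R) : y = halfz (Num.floor (2 * (y : R))).
Proof.
apply: val_inj => /=; have /floorK -> := valP y.
by rewrite mulrC mulKf// pnatr_eq0.
Qed.

Lemma halfzD j k : halfz (j + k) = halfz j + halfz k.
Proof. by apply: val_inj; rewrite /= rmorphD/= mulrDl. Qed.

Lemma halfz0 : halfz 0 = 0.
Proof. by apply: val_inj; rewrite /= mul0r. Qed.

Lemma halfzN k : halfz (- k) = - halfz k.
Proof. by apply: val_inj; rewrite /= rmorphN/= mulNr. Qed.

Lemma halfz_inj : injective halfz.
Proof.
move=> j k /(congr1 val)/= /(mulIf _) jk.
by apply: (@intr_inj R); apply: jk; rewrite invr_eq0 pnatr_eq0.
Qed.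

End half_integers.

Section phi.
Variable R : realType.
Implicit Types (x y : R) (m k : int).

Definition phi x : halfZ R := phi_half (circle_proj x).

Lemma circle_projDz x m : circle_proj (x + m%:~R) = circle_proj x.
Proof. by apply/circle_projP; rewrite addrAC subrr add0r intr_int. Qed.

Lemma phiDz x m : phi (x + m%:~R) = phi x.
Proof. by rewrite /phi circle_projDz. Qed.

Lemma phiE x m : m%:~R <= x < m%:~R + 1 ->
  phi x = halfz R (if x <= m%:~R + 2^-1 then 1 else -1).
Proof.
move=> /andP[mx xm]; apply: val_inj; rewrite /= indicE.
case: ifPn => xm2.
  rewrite mem_set ?rmorph1//=; first lra.
  exists (x - m%:~R); first by rewrite /= in_itv/=; lra.
  by apply/circle_projP; rewrite addrAC subrr add0r rpredN intr_int.
rewrite memNset/= ?rmorphN ?rmorph1 ?sub0r ?mulN1r//.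
move=> [t]; rewrite /= in_itv/= => /andP[t0 t2] /circle_projP/intrP[n tn].
suff : m%:~R < (- n)%:~R :> R /\ (-n)%:~R < m%:~R + 1 :> R.
  rewrite -[1]/(1%:~R) -intrD !ltr_int; lia.
by rewrite rmorphN/=; lra.
Qed.

Lemma phi_around_half_integer m : exists s : int, [/\ s = 1 \/ s = -1,
  (forall x, m%:~R / 2 < x < (m%:~R + 1) / 2 -> phi x = halfz R s) &
  (forall x, (m%:~R - 1) / 2 < x < m%:~R / 2 -> phi x = - halfz R s)].
Proof.
have [h [->|->]] := int_parity m; rewrite ?rmorphD rmorphM/=.
- exists 1; split; first by left.
  + move=> x xh; rewrite (@phiE x h); last lra.
    by rewrite ifT//; lra.
  + move=> x xh; rewrite (@phiE x (h - 1)) ?rmorphB/=; last lra.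
    by rewrite ifF ?halfzN//; apply/negbTE; rewrite -ltNge; lra.
- exists (-1); split; first by right.
  + move=> x xh; rewrite (@phiE x h); last lra.
    by rewrite ifF//; apply/negbTE; rewrite -ltNge; lra.
  + move=> x xh; rewrite (@phiE x h); last lra.
    by rewrite halfzN opprK ifT//; lra.
Qed.

Definition half_integers : set R := [set d | exists m, d = m%:~R / 2].

Lemma half_floor_itv x : (Num.floor (2 * x))%:~R / 2 <= x < ((Num.floor (2 * x))%:~R + 1) / 2.
Proof. by have := floor_itv (2 * x); rewrite intrD; lra. Qed.

(** Discontinuities are described by a set D that contains them; only open
    intervals that avoid D are used, so the values of f on D do not matter. *)
Definition locally_constant_off (G : Type) (f : R -> G) (D : set R) :=
  forall a b x y, (forall d, D d -> ~ a < d < b) ->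
    a < x < b -> a < y < b -> f x = f y.

Lemma phi_locally_constant : locally_constant_off phi half_integers.
Proof.
move=> a b x y noD abx aby.
have := half_floor_itv x; set m := Num.floor _ => /= /andP[mx xm].
have mx' : m%:~R / 2 < x.
  rewrite lt_neqAle mx andbT; apply/eqP => h.
  by apply: (noD (m%:~R / 2)); [exists m|rewrite h].
have ym : m%:~R / 2 < y < (m%:~R + 1) / 2.
  apply/andP; split; rewrite ltNge; apply/negP => h.
    by apply: (noD (m%:~R / 2)); [exists m|lra].
  by apply: (noD ((m%:~R + 1) / 2)); [exists (m + 1); rewrite rmorphD|lra].
have [s [_ sx _]] := phi_around_half_integer m.
by rewrite !sx// mx' xm.
Qed.

Lemma phi_half_turn x : ~ half_integers x -> phi (x + 2^-1) = - phi x.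
Proof.
move=> xD; have := half_floor_itv x; set m := Num.floor _ => /= /andP[mx xm].
have mx' : m%:~R / 2 < x.
  by rewrite lt_neqAle mx andbT; apply/eqP => h; apply: xD; exists m.
have [s [_ sr sl]] := phi_around_half_integer (m + 1).
rewrite rmorphD/= in sr sl.
by rewrite sr ?sl ?opprK//; lra.
Qed.

Lemma phi_values x : phi x = halfz R 1 \/ phi x = halfz R (-1).
Proof.
have := floor_itv x; rewrite intrD => /phiE ->; by case: ifP => _; [left|right].
Qed.

End phi.


(** * Birkhoff sums of the step function *)

Section birkhoff_sums.
Variables (R : realType) (alpha : R).
Implicit Types (x y z d : R) (k n N Q : nat) (m p : int).

Definition birkhoff (G : zmodType) (f : R -> G) n x : G :=
  \sum_(k < n) f (x + k%:R * alpha).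

Lemma birkhoffS (G : zmodType) (f : R -> G) n x :
  birkhoff f n.+1 x = birkhoff f n x + f (x + n%:R * alpha).
Proof. by rewrite /birkhoff big_ord_recr. Qed.

Lemma birkhoffD (G : zmodType) (f : R -> G) n1 n2 x :
  birkhoff f (n1 + n2) x = birkhoff f n1 x + birkhoff f n2 (x + n1%:R * alpha).
Proof.
rewrite /birkhoff big_split_ord /=; congr (_ + _).
by apply: eq_bigr => k _; rewrite natrD mulrDl addrA.
Qed.

Lemma birkhoffN (G : zmodType) (f : R -> G) n x :
  birkhoff (fun x => - f x) n x = - birkhoff f n x.
Proof. by rewrite /birkhoff sumrN. Qed.

Lemma halfZ_valD (u v : halfZ R) : halfZ_val (u + v) = halfZ_val u + halfZ_val v.
Proof. by []. Qed.

Lemma halfZ_valN (u : halfZ R) : halfZ_val (- u) = - halfZ_val u.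
Proof. by []. Qed.

Variable c : R.
Hypotheses (c0 : 0 < c) (alphaP : badly_approximable c alpha).

Lemma half_integer_approximation k m : (0 < k)%N ->
  c <= 4 * k%:R * `|k%:R * alpha - m%:~R / 2|.
Proof.
move=> k0; have := @alphaP (2 * k)%N m; rewrite muln_gt0 k0 natrM => /(_ isT).
have -> : 2 * k%:R * alpha - m%:~R = 2 * (k%:R * alpha - m%:~R / 2) by field.
by rewrite normrM ger0_norm//; lra.
Qed.

(** Two visits k1 < k2 to the half-integers would make 2 (k2 - k1) alpha closer
    to an integer than bad approximability permits. Doubling is what treats the
    jumps at the integers and at the other half-integers together. *)
Lemma orbit_hits_once n (e : R) x k1 k2 m1 m2 : 8 * n%:R * e < c ->
  (k1 < n)%N -> (k2 < n)%N -> `|x + k1%:R * alpha - m1%:~R / 2| <= e ->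
  `|x + k2%:R * alpha - m2%:~R / 2| <= e -> k1 = k2.
Proof.
move=> ne; wlog k12 : k1 k2 m1 m2 / (k1 <= k2)%N => [wlog_k12|].
  move=> k1n k2n h1 h2; have [k12|/ltnW k21] := leqP k1 k2.
    exact: wlog_k12 k12 k1n k2n h1 h2.
  by apply/esym; exact: wlog_k12 k21 k2n k1n h2 h1.
move=> k1n k2n h1 h2; apply/eqP; rewrite eqn_leq k12/= leqNgt; apply/negP => k12'.
have := @half_integer_approximation (k2 - k1)%N (m2 - m1).
rewrite subn_gt0 k12' => /(_ isT).
rewrite natrB// rmorphB/=.
have -> : (k2%:R - k1%:R) * alpha - (m2%:~R - m1%:~R) / 2 =
  (x + k2%:R * alpha - m2%:~R / 2) - (x + k1%:R * alpha - m1%:~R / 2) by field.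
set u := x + _ - _ in h2 *; set v := x + _ - _ in h1 *.
have : `|u - v| <= 2 * e by rewrite (le_trans (ler_normB _ _))//; lra.
set w := `|_|; have : 0 <= w by exact: normr_ge0.
have : 0 <= k1%:R :> R by exact: ler0n.
have : k1%:R <= k2%:R :> R by rewrite ler_nat.
have : k2%:R <= n%:R :> R by rewrite ler_nat ltnW.
move: ne; clear; nra.
Qed.

(** Seen from z = m0 - k0 alpha, at scale e / N, the only half-integer met by the
    orbit is m0 itself, at time k0: the jump of the Birkhoff sum at z is
    isolated. *)
Lemma half_integer_isolated N k0 k m0 m (e : R) : (k0 < N)%N -> (k < N)%N ->
  0 < e -> e <= c / 16 -> e <= 2^-1 ->
  `|m0%:~R - k0%:R * alpha + k%:R * alpha - m%:~R / 2| < e / N%:R ->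
  k = k0 /\ m = 2 * m0.
Proof.
move=> k0N kN e0 ec e2 zk.
have N0 : (0 < N)%N by apply: leq_trans k0N.
have N0R : (0 : R) < N%:R by rewrite ltr0n.
have m0E : m0%:~R - k0%:R * alpha + k0%:R * alpha - (2 * m0)%:~R / 2 = 0.
  by rewrite intrM; field.
have kk0 : k = k0.
  apply: (@orbit_hits_once N (e / N%:R) _ _ _ m (2 * m0) _ kN k0N (ltW zk)).
    have -> : 8 * N%:R * (e / N%:R) = 8 * e by field; rewrite gt_eqF.
    have c0' := c0; lra.
  by rewrite m0E normr0 divr_ge0 ?ltW.
split => //; move: zk; rewrite kk0 subrK => zk.
have : `|(2 * m0 - m)%:~R| < (1%:~R : R).
  rewrite rmorphB rmorphM/=.
  have -> : 2 * m0%:~R - m%:~R = 2 * (m0%:~R - m%:~R / 2) :> R by field.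
  rewrite normrM ger0_norm// rmorph1.
  have eN : e / N%:R <= e by rewrite ler_pdivrMr// ler_peMr ?ler1n// ltW.
  by move: zk eN e2; clear; lra.
rewrite -intr_norm ltr_int => m01.
by clear - m01; lia.
Qed.

(** At most one term of the two sums differs, because the points where f and g
    differ are within e of a half-integer. *)
Lemma birkhoff_close (f g : R -> halfZ R) n (e : R) : 8 * n%:R * e < c ->
  (forall x, f x <> g x -> exists m, `|x - m%:~R / 2| <= e) ->
  (forall x, `|(f x : R) - (g x : R)| <= 1) ->
  forall x, `|(birkhoff f n x : R) - (birkhoff g n x : R)| <= 1.
Proof.
move=> ne fg fg1 x.
have [[k0 fgk0]|nex] := pselect (exists k : 'I_n,
    f (x + k%:R * alpha) <> g (x + k%:R * alpha)); last first.
  have -> : birkhoff f n x = birkhoff g n x.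
    apply: eq_bigr => k _; apply: contrapT => fgk.
    by apply: nex; exists k.
  by rewrite subrr normr0.
have [m0 m0P] := fg _ fgk0.
have rest : \sum_(i < n | i != k0) f (x + i%:R * alpha) =
            \sum_(i < n | i != k0) g (x + i%:R * alpha).
  apply: eq_bigr => k kk0; apply: contrapT => /fg[m mP].
  move/eqP : kk0; apply; apply/val_inj.
  exact: (orbit_hits_once ne (ltn_ord k) (ltn_ord k0) mP m0P).
have -> : (birkhoff f n x : R) - (birkhoff g n x : R) =
    (f (x + k0%:R * alpha) : R) - (g (x + k0%:R * alpha) : R).
  rewrite /birkhoff (bigD1 k0)// rest [in X in _ - X](bigD1 k0)// !halfZ_valD.
  by rewrite opprD addrACA subrr addr0.
exact: fg1.
Qed.

Lemma phi_dist_le1 x y : `|(phi x : R) - (phi y : R)| <= 1.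
Proof.
by have [->|->] := phi_values x; have [->|->] := phi_values y;
  rewrite /= ?rmorphN/= rmorph1 ler_norml; lra.
Qed.

Lemma birkhoff_phi_shift n d M : 8 * n%:R * `|d| < c ->
  forall x, `|(birkhoff (@phi R) n (x + M%:R * d) : R) - (birkhoff (@phi R) n x : R)| <= M%:R.
Proof.
move=> nd x; elim: M => [|M IH]; first by rewrite mul0r addr0 subrr normr0.
(* A radius slightly larger than |d| still satisfying the hypothesis, since the
   local constancy of phi is stated on open intervals. *)
pose e := `|d| + (c - 8 * n%:R * `|d|) / (8 * n%:R + 1).
have n0 : 0 < 8 * n%:R + 1 :> R by rewrite ltr_wpDl// mulr_ge0.
have de : `|d| < e by rewrite /e ltrDl divr_gt0//; lra.
have ne : 8 * n%:R * e < c.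
  have : (c - 8 * n%:R * `|d|) / (8 * n%:R + 1) * (8 * n%:R + 1) = c - 8 * n%:R * `|d|.
    by rewrite divfK// gt_eqF.
  move: de; rewrite /e; set q := _ / _; lra.
clearbody e.
have shift1 y : `|(birkhoff (@phi R) n (y + d) : R) - (birkhoff (@phi R) n y : R)| <= 1.
  have -> : birkhoff (@phi R) n (y + d) = birkhoff (fun y => phi (y + d)) n y.
    by apply: eq_bigr => k _; rewrite addrAC.
  apply: (birkhoff_close ne) => [{}y|{}y]; last exact: phi_dist_le1.
  move=> phine; apply: contrapT => nohit; apply: phine.
  apply: (@phi_locally_constant R (y - e) (y + e)).
  - by move=> _ [m ->] ye; apply: nohit; exists m; rewrite ler_norml; lra.
  - by move: de; rewrite ltr_norml; lra.
  - by have : 0 <= `|d| by [exact: normr_ge0]; lra.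
have -> : x + M.+1%:R * d = x + M%:R * d + d by rewrite -natr1; ring.
have := ler_distD (birkhoff (@phi R) n (x + M%:R * d) : R)
  (birkhoff (@phi R) n (x + M%:R * d + d) : R) (birkhoff (@phi R) n x : R).
by move=> /le_trans; apply; have := shift1 (x + M%:R * d); rewrite -natr1; lra.
Qed.

(** Take N = 2 j where j alpha is within O(1/Q) of 1/2 mod 1, say
    j alpha = 1/2 + d. Then S_N phi x = S_j phi x + S_j phi (x + 1/2 + d), and
    S_j phi (x + 1/2) is - S_j phi x up to one term, while the shift by d costs
    a bounded number of jumps. That j is of order Q follows from bad
    approximability applied to 2 j alpha. *)
Lemma return_times : exists2 C : R, 0 < C & exists B : nat,
  forall Q, (0 < Q)%N -> exists N m, [/\ (0 < N)%N, (N <= 2 * Q)%N,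
    Q%:R <= C * N%:R, `|N%:R * alpha - m%:~R| <= C / Q%:R &
    forall x, `|(birkhoff (@phi R) N x : R)| <= B%:R].
Proof.
pose C0 := 2 / c; have C00 : 0 < C0 by rewrite divr_gt0.
pose M := (Num.truncn (8 * C0 / c)).+1.
have MP : 8 * C0 < c * M%:R.
  by rewrite [ltRHS]mulrC -ltr_pdivrMr//; exact: truncnS_gt.
have M0 : (0 : R) < M%:R by rewrite ltr0n.
exists (2 * C0 / c + 2 * C0); first by rewrite addr_gt0// ?divr_gt0// mulr_gt0.
exists M.+1 => Q Q0; have Q0R : (0 : R) < Q%:R by rewrite ltr0n.
(* Starting at alpha - 1/2 instead of - 1/2 makes j = k + 1 positive. *)
have [k [m [kQ km]]] := orbit_dense c0 alphaP (alpha - 2^-1) Q0.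
rewrite -/C0 in km; pose j := k.+1.
pose d := j%:R * alpha - 2^-1 - m%:~R.
have {}km : `|d| <= C0 / Q%:R.
  by move: km; congr (`|_| <= _); rewrite /d /j -natr1; ring.
have dQ : `|d| * Q%:R <= C0 by rewrite -ler_pdivlMr.
have jQ : j%:R <= Q%:R :> R by rewrite ler_nat.
have j1 : 1 <= j%:R :> R by rewrite ler1n.
have j0 : 0 < j%:R :> R by rewrite ltr0n.
exists (j + j)%N, (1 + 2 * m); split => //.
- by rewrite mul2n -addnn leq_add.
- have := @half_integer_approximation j (1 + 2 * m) isT.
  rewrite rmorphD rmorphM/=.
  have -> : j%:R * alpha - (1 + 2 * m%:~R) / 2 = d by rewrite /d; field.
  move=> cj; rewrite natrD.
  have : c * Q%:R <= 4 * j%:R * C0.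
    have : 4 * j%:R * (`|d| * Q%:R) <= 4 * j%:R * C0 by rewrite ler_pM2l//; lra.
    have := ler_wpM2r (ltW Q0R) cj; lra.
  move=> h; rewrite -(ler_pM2l c0).
  have -> : c * ((2 * C0 / c + 2 * C0) * (j%:R + j%:R)) =
      4 * C0 * j%:R + c * (4 * C0) * j%:R by field; rewrite gt_eqF.
  have : 0 < c * (4 * C0) * j%:R by rewrite mulr_gt0// mulr_gt0// mulr_gt0.
  lra.
- rewrite ler_pdivlMr//.
  have -> : (j + j)%:R * alpha - (1 + 2 * m)%:~R = 2 * d.
    by rewrite rmorphD rmorphM/= natrD /d; field.
  rewrite normrM ger0_norm//.
  have : 0 < 2 * C0 / c by rewrite divr_gt0// mulr_gt0.
  lra.
- move=> x; rewrite birkhoffD -natr1 halfZ_valD.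
  have -> : x + j%:R * alpha = x + 2^-1 + d + m%:~R by rewrite /d; field.
  have -> : birkhoff (@phi R) j (x + 2^-1 + d + m%:~R) = birkhoff (@phi R) j (x + 2^-1 + d).
    by apply: eq_bigr => i _; rewrite addrAC phiDz.
  have turn : `|(birkhoff (@phi R) j (x + 2^-1) : R) - (birkhoff (fun x => - phi x) j x : R)| <= 1.
    have -> : birkhoff (@phi R) j (x + 2^-1) = birkhoff (fun y => phi (y + 2^-1)) j x.
      by apply: eq_bigr => i _; rewrite addrAC.
    apply: (@birkhoff_close _ _ _ 0) => [|y|y]; first by rewrite mulr0.
      move=> ne; apply: contrapT => nohit; apply/ne/phi_half_turn => -[p yp].
      by apply: nohit; exists p; rewrite yp subrr normr0.
    rewrite halfZ_valN.
    by have [->|->] := phi_values y; have [->|->] := phi_values (y + 2^-1);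
      rewrite /= ?rmorphN/= rmorph1 ler_norml; lra.
  have jd : 8 * j%:R * `|d / M%:R| < c.
    rewrite normrM normfV (gtr0_norm M0) mulrA ltr_pdivrMr//.
    apply: le_lt_trans MP; rewrite -mulrA ler_pM2l// (le_trans _ dQ)// mulrC.
    by rewrite ler_wpM2l.
  have := birkhoff_phi_shift M jd (x + 2^-1).
  rewrite mulrC divfK ?gt_eqF//.
  move: turn; rewrite birkhoffN halfZ_valN !ler_norml.
  lra.
Qed.


(** Within distance r of z, only the term of index k0 can jump, and only at z. *)
Lemma birkhoff_near_jump (G : zmodType) (f : R -> G) (D : set R) n k0 z r :
  locally_constant_off f D -> (k0 < n)%N ->
  (forall k d, (k < n)%N -> D d -> `|z + k%:R * alpha - d| < r ->
    k = k0 /\ d = z + k0%:R * alpha) ->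
  [/\ forall x y, z - r < x < z -> z - r < y < z -> birkhoff f n x = birkhoff f n y,
     forall x y, z < x < z + r -> z < y < z + r -> birkhoff f n x = birkhoff f n y &
     forall x y, z - r < x < z -> z < y < z + r ->
       birkhoff f n y - birkhoff f n x =
       f (y + k0%:R * alpha) - f (x + k0%:R * alpha)].
Proof.
move=> fD k0n iso; split => [x y xz yz|x y xz yz|x y xz yz].
- apply: eq_bigr => -[k kn] _ /=.
  apply: (fD (z - r + k%:R * alpha) (z + k%:R * alpha)); [|lra|lra].
  move=> d Dd kd; have [|kk0 dE] := iso k d kn Dd; first by rewrite ltr_norml; lra.
  by move: kd; rewrite dE kk0; lra.
- apply: eq_bigr => -[k kn] _ /=.
  apply: (fD (z + k%:R * alpha) (z + r + k%:R * alpha)); [|lra|lra].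
  move=> d Dd kd; have [|kk0 dE] := iso k d kn Dd; first by rewrite ltr_norml; lra.
  by move: kd; rewrite dE kk0; lra.
- rewrite /birkhoff (bigD1 (Ordinal k0n))//= [X in _ - X](bigD1 (Ordinal k0n))//=.
  have -> : \sum_(i < n | i != Ordinal k0n) f (y + i%:R * alpha) =
            \sum_(i < n | i != Ordinal k0n) f (x + i%:R * alpha).
    apply: eq_bigr => -[k kn] /= kk0.
    apply: (fD (z - r + k%:R * alpha) (z + r + k%:R * alpha)); [|lra|lra].
    move=> d Dd kd; have [|kE _] := iso k d kn Dd; first by rewrite ltr_norml; lra.
    by move/eqP: kk0; apply; apply: val_inj.
  by rewrite opprD addrACA subrr addr0.
Qed.

End birkhoff_sums.


(** * Density points *)

Section almost_everywhere.
Context d (T : measurableType d) (R : realType) (mu : {measure set T -> \bar R}).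
Implicit Types P Q : T -> Prop.

Lemma ae_imply P Q : (forall x, P x -> Q x) ->
  (\forall x \ae mu, P x) -> \forall x \ae mu, Q x.
Proof. by move=> PQ; apply: filterS. Qed.

Lemma ae_and P Q : (\forall x \ae mu, P x) -> (\forall x \ae mu, Q x) ->
  \forall x \ae mu, P x /\ Q x.
Proof. by move=> aeP aeQ; apply: filterI. Qed.

Lemma ae_forall_countable (I : countType) (P : I -> T -> Prop) :
  (forall i, \forall x \ae mu, P i x) -> \forall x \ae mu, forall i, P i x.
Proof.
move=> aeP; have : \forall x \ae mu, forall n : nat, oapp (P^~ x) True (unpickle n).
  by apply: ae_foralln => n; case: unpickle => [i|] /=; [exact: aeP|exact: aeW].
by apply: ae_imply => x Px i; have := Px (pickle i); rewrite pickleK.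
Qed.

End almost_everywhere.

Section lebesgue_density.
Variable R : realType.
Implicit Types (A B : set R) (x y r t : R).
Local Notation lambda := (@lebesgue_measure R).

Let measurable_fun_shift t :
  measurable_fun [set: measurableTypeR R] (fun x => x + t : measurableTypeR R).
Proof. by apply: measurable_funD. Qed.

Lemma measurable_shift t A : measurable A -> measurable ((fun x => x + t) @^-1` A).
Proof.
by move=> mA; rewrite -[X in measurable X]setTI; exact: measurable_fun_shift.
Qed.

Lemma lebesgue_measure_shift t A : measurable A ->
  lambda ((fun x => x + t) @^-1` A) = lambda A.
Proof.
pose s := (fun x => x + t) : measurableTypeR R -> measurableTypeR R.
move=> mA; change (pushforward lambda s A = lambda A).
apply/esym/lebesgue_measure_unique => //=; first exact: measurable_fun_shift.
move=> _ _ [[a b]] _ <-; rewrite /pushforward.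
have -> : s @^-1` `]a, b]%classic = `]a - t, b - t]%classic.
  by apply/seteqP; split => x; rewrite /s /= !in_itv/=; lra.
rewrite !lebesgue_measure_itv/= !lte_fin ltrD2r.
by case: ifP => // _; rewrite -!EFinB; congr EFin; ring.
Qed.


Lemma ae_shift (P : R -> Prop) t : (\forall x \ae lambda, P x) ->
  \forall x \ae lambda, P (x + t).
Proof.
move=> [N [mN N0 PN]]; exists ((fun x => x + t) @^-1` N); split.
- exact: measurable_shift.
- by rewrite lebesgue_measure_shift.
- by move=> x /= Px; apply: PN.
Qed.

Lemma ae_exists (P : R -> Prop) : (\forall x \ae lambda, P x) -> exists x, P x.
Proof.
move=> [N [mN N0 PN]]; apply: contrapT => nP.
have : (lambda `[0%R, 1%R] <= lambda N)%E.
  apply: le_measure; rewrite ?inE//.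
  by move=> x _; apply: PN => Px; apply: nP; exists x.
by rewrite lebesgue_measure_itv/= lte_fin ltr01 N0 sube0 lee_fin ler10.
Qed.

(** A point x0 at which the density of A is 1 or 0, according to whether x0
    belongs to A or not. *)
Definition density_point A x0 := forall e : R, 0 < e -> exists2 r0 : R, 0 < r0 &
  forall r, 0 < r < r0 ->
    (lambda (ball x0 r `&` [set x | ~ (A x <-> A x0)]) <= (e * r)%:E)%E.

Lemma ae_density_point A : measurable A ->
  \forall x \ae lambda, density_point A x.
Proof.
move=> mA; have := ae_and (lebesgue_density mA) (lebesgue_density (measurableC mA)).
apply: ae_imply => x0 [dA dC] e e0.
have small B : (lambda (B `&` ball x0 r) * (lambda (ball x0 r))^-1)%E
      @[r --> 0^'+] --> 0%E ->
    exists2 r0 : R, 0 < r0 & forall r, 0 < r < r0 ->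
      (lambda (ball x0 r `&` B) <= (e * r)%:E)%E.
  move=> H; have : nbhs (0%:E : \bar R) [set y | (y < (e / 2)%:E)%E].
    by apply: open_ereal_lt'; rewrite lte_fin divr_gt0.
  move=> /H /nbhs_ballP[r0 /= r00 hr]; exists r0 => // r /andP[rp rr].
  have := hr r; rewrite /ball/= sub0r normrN gtr0_norm// => /(_ rr rp).
  rewrite -/(ball x0 r) setIC (lebesgue_measure_ball _ (ltW rp)).
  rewrite inver mulrn_eq0/= gt_eqF//.
  rewrite -lte_pdivlMr ?invr_gt0 ?mulrn_wgt0// invrK => h.
  apply: (le_trans (ltW h)); rewrite -EFinM lee_fin -[r *+ 2]mulr_natr; lra.
have [Ax|nAx] := pselect (A x0).
- rewrite (_ : [set x | _] = ~` A); last by apply/seteqP; split => x /=; tauto.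
  by apply: small; move: dC; rewrite indicE memNset//= => h; apply: h.
- rewrite (_ : [set x | _] = A); last first.
    by apply/seteqP; split => x /=; have [|] := pselect (A x); tauto.
  by apply: small; move: dA; rewrite indicE memNset.
Qed.

(** This is how density points are used: an interval of length at least e r
    within r of x0, and whose translate by t is within r of x1, contains a
    point x at which A behaves as at x0 and B behaves at x + t as at x1. Indeed
    the exceptional sets have measure at most e r / 3 each. *)
Lemma density_points_meet A B x0 x1 (e : R) : measurable A -> measurable B ->
  density_point A x0 -> density_point B x1 -> 0 < e ->
  exists2 r0 : R, 0 < r0 & forall r, 0 < r < r0 ->
    forall a b t (Q : R -> Prop), e * r <= b - a ->
    (forall x, a < x < b -> `|x - x0| < r /\ `|x + t - x1| < r) ->
    (\forall x \ae lambda, Q x) ->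
    exists x, [/\ a < x < b, (A x <-> A x0), (B (x + t) <-> B x1) & Q x].
Proof.
move=> mA mB dA dB e0.
have e3 : 0 < e / 3 by rewrite divr_gt0.
have [rA rA0 hA] := dA _ e3; have [rB rB0 hB] := dB _ e3.
exists (Num.min rA rB); first by rewrite lt_min rA0.
move=> r /andP[r0]; rewrite lt_min => /andP[rrA rrB] a b t Q ab sub [N [mN N0 QN]].
apply: contrapT => nex.
have mbad (C : set R) (c : R) : measurable C -> measurable (ball c r `&` [set x | ~ (C x <-> C c)]).
  move=> mC; apply: measurableI; first by rewrite ball_itv; exact: measurable_itv.
  have [Cc|nCc] := pselect (C c).
    rewrite (_ : [set x | _] = ~` C); first exact: measurableC.
    by apply/seteqP; split => x /=; tauto.
  rewrite (_ : [set x | _] = C)//.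
  by apply/seteqP; split => x /=; have [|] := pselect (C x); tauto.
have {hA} := hA r; rewrite r0 rrA => /(_ isT).
have {hB} := hB r; rewrite r0 rrB => /(_ isT).
have := mbad A x0 mA; have := mbad B x1 mB.
set badB := ball x1 r `&` _; set badA := ball x0 r `&` _ => mbadB mbadA muB muA.
pose badB' := (fun x => x + t) @^-1` badB.
have mbadB' : measurable badB' by exact: measurable_shift.
have muB' : lambda badB' = lambda badB by rewrite lebesgue_measure_shift.
have cover : `]a, b[%classic `<=` (badA `|` badB') `|` N.
  move=> x; rewrite /= in_itv/= => /[dup] axb /sub[xx0 xx1].
  apply: contrapT => /not_orP[/not_orP[nA nB] nN].
  apply: nex; exists x; split => //.
  - apply: contrapT => nAx; apply: nA; split => //.
    by rewrite /ball/= distrC.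
  - apply: contrapT => nBx; apply: nB; split => //.
    by rewrite /ball/= distrC.
  - by apply: contrapT => nQ; apply: nN; exact: QN.
have : (lambda `]a, b[ <= lambda badA + lambda badB' + lambda N)%E.
  apply: (@le_trans _ _ (lambda (badA `|` badB' `|` N))).
    apply: le_measure; rewrite ?inE//; by do 2?apply: measurableU.
  apply: (le_trans (measureU2 _ _ _)) => //; first exact: measurableU.
  by rewrite leeD2r// measureU2.
rewrite N0 adde0 muB' leNgt => /negP; apply.
apply: (le_lt_trans (leeD muA muB)).
rewrite lebesgue_measure_itv/= lte_fin.
have er : 0 < e * r by rewrite mulr_gt0.
by rewrite ifT; [rewrite -EFinB -EFinD lte_fin; lra|lra].
Qed.

End lebesgue_density.


(** * Ergodicity of the cylinder map *)

Section invariant_sets.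
Variables (R : realType) (alpha c : R).
Hypotheses (c0 : 0 < c) (alphaP : badly_approximable c alpha).
Implicit Types (x z : R) (y v : halfZ R) (k n N Q : nat) (m p : int).
Local Notation lambda := (@lebesgue_measure R).

Lemma uniform_radius n (P : nat -> R -> Prop) :
  (forall i, exists2 r0 : R, 0 < r0 & forall r, 0 < r < r0 -> P i r) ->
  exists2 r0 : R, 0 < r0 & forall r, 0 < r < r0 -> forall i, (i < n)%N -> P i r.
Proof.
move=> hP; elim: n => [|n [r1 r10 h1]]; first by exists 1.
have [r2 r20 h2] := hP n; exists (Num.min r1 r2); first by rewrite lt_min r10.
move=> r /andP[r0]; rewrite lt_min => /andP[rr1 rr2] i.
rewrite ltnS leq_eqVlt => /predU1P[->|]; first by apply: h2; rewrite r0.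
by apply: h1; rewrite r0.
Qed.

(** Invariant sets are treated for an arbitrary cocycle f, so that the result
    applies to phi, for ergodicity, and to the graph of psi when f is the
    coboundary of psi. *)
Section cocycle.
Variables (f : R -> halfZ R) (A : R -> halfZ R -> Prop).
Hypothesis mA : forall y, measurable [set x | A x y].
Hypothesis Az : forall x m y, A (x + m%:~R) y <-> A x y.
Hypothesis Ainv : \forall x \ae lambda, forall y, A (x + alpha) (y + f x) <-> A x y.

Definition typical x := forall y, density_point [set x | A x y] x.

Lemma ae_typical : \forall x \ae lambda, typical x.
Proof.
have : \forall x \ae lambda, forall k : int, density_point [set x | A x (halfz R k)] x.
  by apply: ae_forall_countable => k; exact: ae_density_point.
by apply: ae_imply => x xk y; rewrite (halfz_surj y).
Qed.

Lemma ae_invariant_iterate n :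
  \forall x \ae lambda, forall y, A (x + n%:R * alpha) (y + birkhoff alpha f n x) <-> A x y.
Proof.
elim: n => [|n IH].
  by apply: aeW => x y; rewrite mul0r addr0 /birkhoff big_ord0 addr0.
apply: ae_imply (ae_and IH (ae_shift (n%:R * alpha) Ainv)) => x [xn xS] y.
by rewrite -xn -xS birkhoffS -natr1 mulrDl mul1r !addrA.
Qed.

(** Since N alpha is within O(1/N) of the integer m, x and x + N alpha - m are
    both near x0 for x in ]a, b[, and invariance reads
    A (x + N alpha - m) (y + v) <-> A x y there. The bound B on v leaves finitely
    many sections A _ (y + v), hence one radius r0 for all of them. *)
Lemma birkhoff_value_symmetry x0 y (C K e : R) (B : nat) : typical x0 ->
  0 < C -> 0 < K -> 0 < e ->
  exists Q0, forall Q N m a b v, (Q0 <= Q)%N -> (0 < N)%N -> (N <= 2 * Q)%N ->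
    Q%:R <= C * N%:R -> `|N%:R * alpha - m%:~R| <= C / Q%:R ->
    e / N%:R <= b - a ->
    (forall x, a < x < b -> `|x - x0| <= K / N%:R /\ birkhoff alpha f N x = v) ->
    `|(v : R)| <= B%:R -> (A x0 y <-> A x0 (y + v)).
Proof.
move=> tx0 C0 K0 e0.
pose K' := K + 2 * C + 1; have K'0 : 0 < K' by rewrite /K'; lra.
have eK'0 : 0 < e / K' by rewrite divr_gt0.
pose w (i : nat) : halfZ R := halfz R (i%:Z - (2 * B)%:Z).
have [r0 r00 hr] := @uniform_radius (4 * B).+1 _
  (fun i => density_points_meet (mA y) (mA (y + w i)) (tx0 y) (tx0 (y + w i)) eK'0).
pose Q0 := (Num.truncn (K' * C / r0)).+1.
exists Q0 => Q N m a b v Q0Q N0 NQ QN Nm eab hx vB.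
have Q0R : (0 : R) < Q%:R by rewrite ltr0n (leq_trans _ Q0Q).
have N0R : (0 : R) < N%:R by rewrite ltr0n.
have K'Q : K' * C < r0 * Q%:R.
  rewrite [ltRHS]mulrC -ltr_pdivrMr//.
  by apply: (@lt_le_trans _ _ Q0%:R); rewrite ?ler_nat//; exact: truncnS_gt.
have rN : 0 < K' / N%:R < r0.
  rewrite divr_gt0//= ltr_pdivrMr// -(ltr_pM2r C0).
  apply: (lt_le_trans K'Q); rewrite -mulrA ler_pM2l//; lra.
have [i iB vi] : exists2 i, (i < (4 * B).+1)%N & v = w i.
  have vE := halfz_surj v; set p := Num.floor _ in vE.
  have : `|p%:~R : R| <= (2 * B)%:R.
    by move: vB; rewrite vE /= normrM normfV natrM (@ger0_norm _ 2)//; lra.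
  rewrite ler_norml pmulrn -rmorphN !ler_int => /andP[p1 p2].
  exists (absz (p + (2 * B)%:Z)).
    by clear - p1 p2; lia.
  by rewrite vE /w; congr halfz; clear - p1 p2; lia.
have := hr _ rN i iB a b (N%:R * alpha - m%:~R).
move=> /(_ (fun x => forall y, A (x + N%:R * alpha) (y + birkhoff alpha f N x) <-> A x y)).
case.
- by rewrite mulrA divfK ?gt_eqF.
- move=> x /hx[xx0 _].
  have CN : C / Q%:R <= 2 * C / N%:R.
    rewrite ler_pdivlMr// mulrAC ler_pdivrMr//.
    have : N%:R <= 2 * Q%:R :> R by rewrite -natrM ler_nat.
    nra.
  have E : K' / N%:R = K / N%:R + 2 * C / N%:R + N%:R^-1 by rewrite /K'; field; rewrite gt_eqF.
  have N1 : 0 < N%:R^-1 :> R by rewrite invr_gt0.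
  have C1 : 0 < C / Q%:R by rewrite divr_gt0.
  split; first lra.
  rewrite addrAC (le_lt_trans (ler_normD _ _))//; lra.
- exact: ae_invariant_iterate.
- move=> x [/hx[_ xv]] /= h1 h2 h3.
  by rewrite -vi in h2; rewrite -h2 -h1 -xv addrA -rmorphN Az h3.
Qed.

End cocycle.

(** Membership is the same at any two density points, since the orbit of one
    comes arbitrarily close to the other. *)
Lemma rotation_ergodic (P : set R) : measurable P ->
  (forall x m, P (x + m%:~R) <-> P x) ->
  (\forall x \ae lambda, P (x + 2 * alpha) <-> P x) ->
  (\forall x \ae lambda, P x) \/ (\forall x \ae lambda, ~ P x).
Proof.
move=> mP Pz Pinv.
have Pk k : \forall x \ae lambda, P (x + k%:R * (2 * alpha)) <-> P x.
  elim: k => [|k IH]; first by apply: aeW => x; rewrite mul0r addr0.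
  apply: ae_imply (ae_and IH (ae_shift (k%:R * (2 * alpha)) Pinv)) => x [xk xS].
  by rewrite -xk -xS -natr1 mulrDl mul1r addrA.
have dP := ae_density_point mP.
have PP x0 x1 : density_point P x0 -> density_point P x1 -> (P x0 <-> P x1).
  move=> d0 d1; have [r0 r00 hr] := density_points_meet mP mP d0 d1 ltr01.
  have C00 : 0 < 2 / c by rewrite divr_gt0.
  pose N := (Num.truncn (8 * (2 / c) / r0)).+1.
  have N0R : (0 : R) < N%:R by rewrite ltr0n.
  have hN : 2 * (2 / c / N%:R) < r0 / 4.
    rewrite mulrA ltr_pdivrMr// mulrAC ltr_pdivlMr// [ltRHS]mulrC -ltr_pdivrMr//.
    have -> : 2 * (2 / c) * 4 / r0 = 8 * (2 / c) / r0 by congr (_ / _); ring.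
    exact: truncnS_gt.
  (* Halving x0 - x1 turns an estimate for alpha into one for 2 alpha. *)
  have [k [m [_ km]]] := orbit_dense c0 alphaP ((x0 - x1) / 2) (ltn0Sn N.-1).
  have close : `|x0 + (k%:R * (2 * alpha) - (2 * m)%:~R) - x1| <= 2 * (2 / c / N%:R).
    rewrite (_ : x0 + _ - _ = 2 * ((x0 - x1) / 2 + k%:R * alpha - m%:~R)).
      by rewrite normrM ger0_norm// ler_pM2l.
    by rewrite intrM; field.
  have r2 : 0 < r0 / 2 < r0 by lra.
  have := hr _ r2 (x0 - r0 / 4) (x0 + r0 / 4) (k%:R * (2 * alpha) - (2 * m)%:~R) _ _ _ (Pk k).
  case; [lra| |].
  - move=> x xx0; split; first by rewrite ltr_norml; lra.
    by move: close; rewrite ler_norml ltr_norml; lra.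
  - by move=> x [_ <- <-]; rewrite addrA -rmorphN Pz => ->.
have [x0 d0] := ae_exists dP.
by have [Px0|nPx0] := pselect (P x0); [left|right];
  apply: ae_imply dP => x dx; rewrite (PP x x0).
Qed.

(** Each point is within O(1/N) of a jump of S_N phi; there the sum is constant on
    both sides at scale 1/N, with values that differ by 1. *)
Lemma birkhoff_jump_near x0 N : (0 < N)%N -> exists z v (s : int),
  [/\ s = 2 \/ s = -2, `|z - x0| <= 2 / c / N%:R,
   forall x, z - c / 16 / N%:R < x < z -> birkhoff alpha (@phi R) N x = v &
   forall x, z < x < z + c / 16 / N%:R -> birkhoff alpha (@phi R) N x = v + halfz R s].
Proof.
move=> N0; have N0R : (0 : R) < N%:R by rewrite ltr0n.
have [k0 [m0 [k0N km]]] := orbit_dense c0 alphaP x0 N0.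
pose z := m0%:~R - k0%:R * alpha; set r := c / 16 / N%:R.
have r0 : 0 < r by rewrite !divr_gt0.
have c16 : 0 < c / 16 by rewrite divr_gt0.
have c2 : c / 16 <= 2^-1 by have := badly_approximable_le1 alphaP; lra.
have r2 : r <= 2^-1.
  by rewrite (le_trans _ c2)// ler_pdivrMr// ler_peMr ?ler1n// ltW.
have zk0 : z + k0%:R * alpha = m0%:~R by rewrite /z subrK.
have iso k d : (k < N)%N -> half_integers d -> `|z + k%:R * alpha - d| < r ->
    k = k0 /\ d = z + k0%:R * alpha.
  move=> kN [m ->] /(half_integer_isolated c0 alphaP k0N kN c16 (lexx _) c2)[-> ->].
  by rewrite zk0 intrM mulrC mulKf.
have [left_cst right_cst jump] := birkhoff_near_jump (@phi_locally_constant R) k0N iso.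
have [s [s1 phir phil]] := phi_around_half_integer R (2 * m0).
have m0E : (2 * m0)%:~R = 2 * m0%:~R :> R by rewrite intrM.
rewrite m0E in phir phil.
exists z, (birkhoff alpha (@phi R) N (z - r / 2)), (s + s); split.
- by case: s1 => ->; [left|right].
- by rewrite distrC opprB addrA.
- by move=> x xz; apply: left_cst => //; lra.
- move=> x xz; have zr : z - r < z - r / 2 < z by lra.
  have := jump _ _ zr xz; rewrite phir; last by move: zk0; lra.
  rewrite phil; last by move: zk0; lra.
  by rewrite opprK -halfzD => <-; rewrite addrC subrK.
Qed.

Section cylinder_ergodicity.
Variable A : R -> halfZ R -> Prop.
Hypothesis mA : forall y, measurable [set x | A x y].
Hypothesis Az : forall x m y, A (x + m%:~R) y <-> A x y.
Hypothesis Ainv :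
  \forall x \ae lambda, forall y, A (x + alpha) (y + phi x) <-> A x y.

(** Below, halfz R 2 is the integer 1. The heights above x0 are invariant under
    the values that S_N phi takes on the two sides of a jump near x0, and these
    differ by 1; the same N serves y and y + 1. *)
Let integer_symmetry x0 : typical A x0 -> forall y, A x0 y <-> A x0 (y + halfz R 2).
Proof.
move=> tx0.
have [C C0 [B timesP]] := return_times c0 alphaP.
pose K := 2 / c + c; have K0 : 0 < K by rewrite addr_gt0// divr_gt0.
have e0 : 0 < c / 16 by rewrite divr_gt0.
have key y : exists Q0, forall Q N m z v (s : int), (Q0 <= Q)%N -> (0 < N)%N ->
    (N <= 2 * Q)%N -> Q%:R <= C * N%:R -> `|N%:R * alpha - m%:~R| <= C / Q%:R ->
    (forall x, `|(birkhoff alpha (@phi R) N x : R)| <= B%:R) ->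
    `|z - x0| <= 2 / c / N%:R ->
    (forall x, z - c / 16 / N%:R < x < z -> birkhoff alpha (@phi R) N x = v) ->
    (forall x, z < x < z + c / 16 / N%:R -> birkhoff alpha (@phi R) N x = v + halfz R s) ->
    (A x0 y <-> A x0 (y + v)) /\ (A x0 y <-> A x0 (y + (v + halfz R s))).
  have [Q0 hQ0] := birkhoff_value_symmetry mA Az Ainv y B tx0 C0 K0 e0.
  exists Q0 => Q N m z v s Q0Q N0 NQ QN Nm SB zx0 Sl Sr.
  have N0R : (0 : R) < N%:R by rewrite ltr0n.
  have r0 : 0 < c / 16 / N%:R by rewrite divr_gt0.
  have KE : K / N%:R = 2 / c / N%:R + 16 * (c / 16 / N%:R) by rewrite /K; field; rewrite !gt_eqF.
  move: zx0; rewrite ler_norml => zx0.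
  set r := c / 16 / N%:R in r0 Sl Sr KE *.
  split.
  - apply: (hQ0 Q N m (z - r) z) => //; first by rewrite -/r; lra.
      by move=> x xz; split; [rewrite ler_norml KE; lra|exact: Sl].
    by rewrite -(Sl (z - r / 2)) ?SB//; lra.
  - apply: (hQ0 Q N m z (z + r)) => //; first by rewrite -/r; lra.
      by move=> x xz; split; [rewrite ler_norml KE; lra|exact: Sr].
    by rewrite -(Sr (z + r / 2)) ?SB//; lra.
move=> y; have [Q1 h1] := key y; have [Q2 h2] := key (y + halfz R 2).
pose Q := (maxn Q1 Q2).+1.
have [N [m [N0 NQ QN Nm SB]]] := timesP Q isT.
have [z [v [s [s2 zx0 Sl Sr]]]] := birkhoff_jump_near x0 N0.
have QQ1 : (Q1 <= Q)%N by rewrite leqW// leq_maxl.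
have QQ2 : (Q2 <= Q)%N by rewrite leqW// leq_maxr.
have [a1 a2] := h1 Q N m z v s QQ1 N0 NQ QN Nm SB zx0 Sl Sr.
have [b1 b2] := h2 Q N m z v s QQ2 N0 NQ QN Nm SB zx0 Sl Sr.
case: s2 => sE.
- by rewrite a2 b1 sE -addrA (addrC v).
- rewrite b2 a1 sE halfzN.
  by rewrite (_ : y + halfz R 2 + (v - halfz R 2) = y + v)// addrA addrAC addrK.
Qed.

Lemma cylinder_ergodic : (\forall x \ae lambda, forall y, A x y) \/
  (\forall x \ae lambda, forall y, ~ A x y).
Proof.
have sym : \forall x \ae lambda, forall y, A x y <-> A x (y + halfz R 2).
  by apply: ae_imply (ae_typical mA) => x; exact: integer_symmetry.
have symz : \forall x \ae lambda, forall (j : int) y, A x y <-> A x (y + halfz R (2 * j)).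
  apply: ae_imply sym => x xs j; have symn (n : nat) y : A x y <-> A x (y + halfz R (2 * n%:Z)).
    elim: n => [|n IH]; first by rewrite mulr0 halfz0 addr0.
    have -> : y + halfz R (2 * n.+1%:Z) = y + halfz R (2 * n%:Z) + halfz R 2.
      by rewrite -addrA -halfzD; congr (y + halfz R _); lia.
    by rewrite -xs.
  move=> y; have [j0|j0] := leP 0 j; first by rewrite -(gez0_abs j0) -symn.
  rewrite (symn (absz j) (y + halfz R (2 * j))) -addrA -halfzD.
  have -> : 2 * j + 2 * absz j = 0 by lia.
  by rewrite halfz0 addr0.
pose P := [set x | A x 0].
have mP : measurable P by exact: mA.
have Pz x m : P (x + m%:~R) <-> P x by exact: Az.
have Pinv : \forall x \ae lambda, P (x + 2 * alpha) <-> P x.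
  have := ae_and (ae_invariant_iterate Ainv 2) (ae_shift (2 * alpha) symz).
  apply: ae_imply => x [xinv xsym].
  have [j Sj] : exists j, birkhoff alpha (@phi R) 2 x = halfz R (2 * j).
    rewrite 2!birkhoffS [X in X + _ + _]big_ord0 add0r.
    case: (phi_values (x + 0%:R * alpha)) => ->;
      case: (phi_values (x + 1%:R * alpha)) => ->; rewrite -halfzD.
    - by exists 1.
    - by exists 0.
    - by exists 0.
    - by exists (-1).
  by rewrite /P/= (xsym j) -Sj xinv.
(* By the symmetry under integers, the section at an integer height is P, and
   that at another height is the image of P by one step of T. *)
have cover : \forall x \ae lambda, forall y, (A x y <-> P x) \/ (A x y <-> P (x - alpha)).
  have := ae_and symz (ae_shift (- alpha) Ainv).
  apply: ae_imply => x [xsym xinv] y; rewrite (halfz_surj y); set k := Num.floor _.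
  have [h [->|->]] := int_parity k; first by left; rewrite /P/= (xsym h 0) add0r.
  right; rewrite /P/= -xinv add0r subrK.
  case: (phi_values (x - alpha)) => ->.
    by rewrite (xsym h (halfz R 1)) -halfzD addrC.
  by rewrite (xsym (h + 1) (halfz R (-1))) -halfzD (_ : -1 + 2 * (h + 1) = 2 * h + 1)//; lia.
have [aeP|aeP] := rotation_ergodic mP Pz Pinv; [left|right];
  have := ae_and cover (ae_and aeP (ae_shift (- alpha) aeP));
  by apply: ae_imply => x [xc [Px Px']] y; case: (xc y); tauto.
Qed.

End cylinder_ergodicity.
End invariant_sets.


(** * Coboundaries *)

Section coboundaries.
Variables (R : realType) (alpha c : R).
Hypotheses (c0 : 0 < c) (alphaP : badly_approximable c alpha).
Implicit Types (x z : R) (y v : halfZ R) (k N Q : nat) (m p l n : int).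
Local Notation lambda := (@lebesgue_measure R).

(** The graph psi x = y is an invariant set for the cocycle f, so
    birkhoff_value_symmetry shows that the values of S_N f on intervals of
    length of order 1/N near a typical x0 are zero, on both sides of z. *)
Lemma coboundary_no_isolated_jump (f : R -> halfZ R) (D : set R) (psi : R -> halfZ R) :
  locally_constant_off f D ->
  (forall B : nat, exists B' : nat, forall N,
    (forall x, `|(birkhoff alpha (@phi R) N x : R)| <= B%:R) ->
    forall x, `|(birkhoff alpha f N x : R)| <= B'%:R) ->
  (forall y, measurable [set x | psi x = y]) ->
  (forall x m, psi (x + m%:~R) = psi x) ->
  (\forall x \ae lambda, psi (x + alpha) = psi x + f x) ->
  exists x0 (C : R), 0 < C /\ forall e : R, 0 < e -> exists Q0, forall Q, (Q0 <= Q)%N ->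
    exists N, [/\ (0 < N)%N, (N <= 2 * Q)%N, Q%:R <= C * N%:R &
      forall k0 z, (k0 < N)%N -> `|z - x0| <= 2 / c / N%:R ->
      (forall k d, (k < N)%N -> D d -> `|z + k%:R * alpha - d| < e / N%:R ->
        k = k0 /\ d = z + k0%:R * alpha) ->
      exists x x', [/\ z - e / N%:R < x < z, z < x' < z + e / N%:R &
        f (x' + k0%:R * alpha) = f (x + k0%:R * alpha)]].
Proof.
move=> fD fB mpsi psiz psif.
have [C C0 [B timesP]] := return_times c0 alphaP.
have [B' BB'] := fB B.
pose A x y := psi x = y.
have Az x m y : A (x + m%:~R) y <-> A x y by rewrite /A psiz.
have Ainv : \forall x \ae lambda, forall y, A (x + alpha) (y + f x) <-> A x y.
  apply: ae_imply psif => x px y; rewrite /A px.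
  by split => [/addIr|->].
have [x0 tx0] := ae_exists (ae_typical mpsi).
exists x0, C; split => // e e0.
have K0 : 0 < 2 / c + e by rewrite addr_gt0// divr_gt0.
have [Q1 hQ1] := birkhoff_value_symmetry mpsi Az Ainv (psi x0) B' tx0 C0 K0 e0.
exists Q1.+1 => Q Q1Q; have Q0 : (0 < Q)%N by apply: leq_trans Q1Q.
have [N [m [N0 NQ QN Nm SB]]] := timesP Q Q0.
exists N; split => // k0 z k0N zx0 iso.
have N0R : (0 : R) < N%:R by rewrite ltr0n.
have r0 : 0 < e / N%:R by rewrite divr_gt0.
have KE : (2 / c + e) / N%:R = 2 / c / N%:R + e / N%:R by rewrite mulrDl.
move: zx0; rewrite ler_norml => zx0.
have [left_cst right_cst jump] := birkhoff_near_jump fD k0N iso.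
set r := e / N%:R in r0 KE left_cst right_cst jump *.
have zero a b x : r <= b - a -> (forall t, a < t < b -> z - r < t < z + r) ->
    a < x < b ->
    (forall t, a < t < b -> birkhoff alpha f N t = birkhoff alpha f N x) ->
    birkhoff alpha f N x = 0.
  move=> rab abz axb cst; have := hQ1 Q N m a b (birkhoff alpha f N x) (ltnW Q1Q) N0 NQ QN Nm rab.
  case.
  - move=> t tab; split; last exact: cst.
    by have := abz t tab; rewrite KE ler_norml; lra.
  - exact: BB'.
  - move=> + _; rewrite /A => /(_ erefl) /(congr1 (fun u => - psi x0 + u)).
    by rewrite addKr addNr.
exists (z - r / 2), (z + r / 2); split; [lra|lra|].
have zl : z - r < z - r / 2 < z by lra.
have zr : z < z + r / 2 < z + r by lra.
have Sl : birkhoff alpha f N (z - r / 2) = 0.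
  apply: (zero (z - r) z _ _ _ zl); first by rewrite opprB addrC subrK.
    by move=> t /andP[? tz]; apply/andP; split => //; apply: (lt_trans tz); rewrite ltrDl.
  by move=> t tz; exact: left_cst tz zl.
have Sr : birkhoff alpha f N (z + r / 2) = 0.
  apply: (zero z (z + r) _ _ _ zr); first by rewrite addrAC subrr add0r.
    by move=> t /andP[tz ?]; apply/andP; split => //; apply: lt_trans tz; rewrite ltrBlDr ltrDl.
  by move=> t tz; exact: right_cst tz zr.
by apply/eqP; rewrite -subr_eq0 -(jump _ _ zl zr) Sl Sr subr0.
Qed.

(** The integers l found at scales Q and Q + 1 coincide: otherwise 2 (l' - l) alpha
    would be within 2 c / 25 / Q of an integer although |2 (l' - l)| <= 12 Q, and
    24 c / 25 < c. So one l works at all scales. *)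
Lemma stable_approximation (u : R) (Q0 : nat) :
  (forall Q, (Q0 <= Q)%N -> exists l n, `|l| <= (2 * Q)%:Z /\
    `|2 * l%:~R * alpha + u - n%:~R| <= c / 25 / Q%:R) ->
  exists l n, 2 * l%:~R * alpha + u = n%:~R.
Proof.
move=> approx.
have c1 := badly_approximable_le1 alphaP.
have step Q l n l' n' : (0 < Q)%N -> `|l| <= (2 * Q)%:Z -> `|l'| <= (2 * Q.+1)%:Z ->
    `|2 * l%:~R * alpha + u - n%:~R| <= c / 25 / Q%:R ->
    `|2 * l'%:~R * alpha + u - n'%:~R| <= c / 25 / Q.+1%:R -> l' = l /\ n' = n.
  move=> Q0' lQ lQ' h h'.
  have Q0R : (0 : R) < Q%:R by rewrite ltr0n.
  have {h'} h' : `|2 * l'%:~R * alpha + u - n'%:~R| <= c / 25 / Q%:R.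
    apply: (le_trans h'); rewrite ler_pM2l ?divr_gt0// lef_pV2 ?posrE ?ltr0n//.
    by rewrite ler_nat.
  have d : `|(2 * (l' - l))%:~R * alpha - (n' - n)%:~R| <= 2 * (c / 25 / Q%:R).
    rewrite (_ : _ - _ = (2 * l'%:~R * alpha + u - n'%:~R) - (2 * l%:~R * alpha + u - n%:~R)).
      by apply: (le_trans (ler_normB _ _)); move: h h'; clear; lra.
    by rewrite rmorphM !rmorphB/=; ring.
  have Q1 : 1 <= Q%:R :> R by rewrite ler1n.
  have dQ : 2 * (c / 25 / Q%:R) * Q%:R = 2 * c / 25 by field; rewrite gt_eqF.
  have ll : l' = l.
    apply/eqP; rewrite -subr_eq0; apply/negPn/negP => ne0.
    pose k := absz (2 * (l' - l)).
    have k0 : (0 < k)%N by rewrite /k; clear - ne0; lia.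
    have kQ : (k <= 12 * Q)%N by rewrite /k; clear - lQ lQ' Q0'; lia.
    have : c <= k%:R * `|(2 * (l' - l))%:~R * alpha - (n' - n)%:~R|.
      have [l0|l0] := leP 0 (2 * (l' - l)).
        have -> : (2 * (l' - l))%:~R = k%:R :> R by rewrite -(gez0_abs l0) -pmulrn.
        exact: alphaP.
      have -> : (2 * (l' - l))%:~R = - k%:R :> R.
        by rewrite -[LHS]opprK -mulrNz -(ltz0_abs l0) -pmulrn.
      rewrite mulNr -opprD normrN -[(n' - n)%:~R]opprK -mulrNz.
      exact: alphaP.
    set w := `|_| in d *.
    have kQR : k%:R <= 12 * Q%:R :> R by rewrite -natrM ler_nat.
    have w0 : 0 <= w by exact: normr_ge0.
    have := ler_wpM2r w0 kQR.
    have : 12 * Q%:R * w <= 12 * (2 * c / 25).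
      by rewrite -dQ -mulrA ler_pM2l// mulrC ler_pM2r.
    move: c0; clear; lra.
  split => //; move: d; rewrite ll subrr mulr0 mul0r sub0r normrN.
  have -> : 2 * (c / 25 / Q%:R) = 2 * c / 25 / Q%:R by ring.
  rewrite ler_pdivlMr// => d.
  have : `|(n' - n)%:~R| < (1%:~R : R).
    have : 0 <= `|(n' - n)%:~R| :> R by exact: normr_ge0.
    rewrite rmorph1; move: d Q1 c1; clear; nra.
  by rewrite -intr_norm ltr_int; clear; lia.
have [l0 [n0 [lQ h0]]] := approx Q0.+1 (leqnSn _).
exists l0, n0.
have all_Q i : `|l0| <= (2 * (Q0.+1 + i))%N%:Z /\
    `|2 * l0%:~R * alpha + u - n0%:~R| <= c / 25 / (Q0.+1 + i)%N%:R.
  elim: i => [|i [IHl IH]]; first by rewrite addn0.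
  have [|l' [n' [lQ' h']]] := approx (Q0.+1 + i).+1; first by lia.
  have [ll nn] := step (Q0 + i).+1 _ _ _ _ isT IHl lQ' IH h'.
  by rewrite addnS; move: lQ' h'; rewrite ll nn.
apply/eqP; rewrite -subr_eq0; apply/negPn/negP => ne0.
have w0 : 0 < `|2 * l0%:~R * alpha + u - n0%:~R| by rewrite normr_gt0.
set w := `|_| in w0 all_Q.
pose i := (Num.truncn (c / 25 / w)).+1.
have iw : c / 25 < w * i%:R.
  by rewrite [ltRHS]mulrC -ltr_pdivrMr//; exact: truncnS_gt.
have [_] := all_Q i; rewrite ler_pdivlMr ?ltr0n// leNgt => /negP; apply.
by apply: (lt_le_trans iw); rewrite ler_pM2l// ler_nat leq_addl.
Qed.


Lemma phi_jump_at_integer m x x' :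
  m%:~R - 2^-1 < x < m%:~R -> m%:~R < x' < m%:~R + 2^-1 -> phi x' <> phi x.
Proof.
have [s [s1 phir phil]] := phi_around_half_integer R (2 * m).
have mE : (2 * m)%:~R = 2 * m%:~R :> R by rewrite intrM.
rewrite mE in phir phil => xm mx; rewrite phir ?phil; [|lra|lra].
by rewrite -halfzN => /halfz_inj; case: s1 => ->.
Qed.

Let scale := Num.min (c / 16) 2^-1.

Let scaleP : [/\ 0 < scale, scale <= c / 16 & scale <= 2^-1].
Proof.
by rewrite /scale lt_min divr_gt0//= invr_gt0 ltr0n !ge_min !lexx orbT.
Qed.

Lemma double_phi_not_coboundary (psi : R -> halfZ R) :
  (forall y, measurable [set x | psi x = y]) ->
  (forall x m, psi (x + m%:~R) = psi x) ->
  ~ (\forall x \ae lambda, psi (x + alpha) = psi x + (phi x + phi x)).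
Proof.
move=> mpsi psiz psif; pose f x := phi x + phi x : halfZ R.
have fE N x : birkhoff alpha f N x = birkhoff alpha (@phi R) N x + birkhoff alpha (@phi R) N x.
  by rewrite /birkhoff -big_split.
have fD : locally_constant_off f (@half_integers R).
  by move=> a b x y h1 h2 h3; rewrite /f (phi_locally_constant h1 h2 h3).
have fB (B : nat) : exists B' : nat, forall N,
    (forall x, `|(birkhoff alpha (@phi R) N x : R)| <= B%:R) ->
    forall x, `|(birkhoff alpha f N x : R)| <= B'%:R.
  exists (B + B)%N => N SB x; rewrite fE halfZ_valD natrD.
  by rewrite (le_trans (ler_normD _ _))// lerD.
have [x0 [C [_ hC]]] := coboundary_no_isolated_jump fD fB mpsi psiz psif.
have [e0 ec e2] := scaleP; have [Q0 /(_ Q0.+1 (leqnSn _))[N [N0 _ _ iso]]] := hC _ e0.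
have N0R : (0 : R) < N%:R by rewrite ltr0n.
have [k0 [m0 [k0N km]]] := orbit_dense c0 alphaP x0 N0.
have [||x [x' [xz x'z]]] := iso k0 (m0%:~R - k0%:R * alpha) k0N.
- by rewrite distrC opprB addrA.
- move=> k d kN [m ->] /(half_integer_isolated c0 alphaP k0N kN e0 ec e2)[-> ->].
  by rewrite subrK intrM mulrC mulKf.
have r2 : scale / N%:R <= 2^-1.
  by rewrite (le_trans _ e2)// ler_pdivrMr// ler_peMr ?ler1n// ltW.
have xm : m0%:~R - 2^-1 < x + k0%:R * alpha < m0%:~R.
  by move: xz r2; clear; set r := _ / _; lra.
have x'm : m0%:~R < x' + k0%:R * alpha < m0%:~R + 2^-1.
  by move: x'z r2; clear; set r := _ / _; lra.
have := phi_jump_at_integer xm x'm; rewrite /f => ne eq2; apply: ne; apply: val_inj.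
by move: eq2 => /(congr1 (@halfZ_val R)); rewrite !halfZ_valD /=; lra.
Qed.

Definition signed (b : bool) (u : halfZ R) : halfZ R := if b then - u else u.

Lemma signedK b : involutive (signed b).
Proof. by case: b => u; rewrite /signed ?opprK. Qed.

Lemma signedD b u v : signed b (u + v) = signed b u + signed b v.
Proof. by case: b; rewrite /signed ?opprD. Qed.

(** Near x0 there is a jump z = m0 - k0 alpha of S_N phi. If no jump
    m / 2 - beta - k alpha of S_N phi (. + beta) came within e / N of z, the jump at
    z would be isolated, and across it the Birkhoff sum would vary only by the
    term of index k0, in which phi jumps and phi (. + beta) does not. Hence such
    m and k exist, and they give the approximation of 2 beta required by
    stable_approximation with l = k - k0. *)
Lemma phi_translate_coboundary (beta : R) (b : bool) (psi : R -> halfZ R) :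
  (forall y, measurable [set x | psi x = y]) ->
  (forall x m, psi (x + m%:~R) = psi x) ->
  (\forall x \ae lambda, psi (x + alpha) = psi x + (phi (x + beta) - signed b (phi x))) ->
  exists l n, 2 * l%:~R * alpha + 2 * beta = n%:~R.
Proof.
move=> mpsi psiz psif; pose f x := phi (x + beta) - signed b (phi x) : halfZ R.
(* When beta is a half-integer the two families of jumps coincide, but then
   l = 0 will do. *)
have [[p betaE]|nbeta] := pselect (half_integers beta).
  by exists 0, p; rewrite betaE mulr0 mul0r add0r; field.
have fE N x : birkhoff alpha f N x =
    birkhoff alpha (@phi R) N (x + beta) - signed b (birkhoff alpha (@phi R) N x).
  elim: N => [|N IH].
    by rewrite /birkhoff !big_ord0 /signed; case: (b); rewrite ?oppr0 ?addr0.
  by rewrite !birkhoffS IH signedD opprD addrACA [in RHS](addrAC x).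
pose D := [set d : R | half_integers d \/ half_integers (d + beta)].
have fD : locally_constant_off f D.
  move=> a a' x y noD xa ya; rewrite /f (@phi_locally_constant R a a' x y)//; last first.
    by move=> d dD; apply: noD; left.
  rewrite (@phi_locally_constant R (a + beta) (a' + beta) (x + beta) (y + beta))//; last 2 first.
  - by rewrite !ltrD2r.
  - by rewrite !ltrD2r.
  move=> d dD da; apply: (noD (d - beta)); first by right; rewrite subrK.
  by rewrite ltrBrDr ltrBlDr.
have fB (B : nat) : exists B' : nat, forall N,
    (forall x, `|(birkhoff alpha (@phi R) N x : R)| <= B%:R) ->
    forall x, `|(birkhoff alpha f N x : R)| <= B'%:R.
  exists (B + B)%N => N SB x; rewrite fE halfZ_valD halfZ_valN natrD.
  rewrite (le_trans (ler_normB _ _))// lerD//.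
  by rewrite /signed; case: (b); rewrite ?halfZ_valN ?normrN.
have [x0 [C [C0 hC]]] := coboundary_no_isolated_jump fD fB mpsi psiz psif.
have [s0 sc s2] := scaleP.
pose e := Num.min scale (c / 50 / C).
have e0 : 0 < e by rewrite lt_min s0/= !divr_gt0.
have es : e <= scale by rewrite ge_min lexx.
have ec := le_trans es sc; have e2 := le_trans es s2.
have eC : 2 * e * C <= c / 25.
  have : e <= c / 50 / C by rewrite ge_min lexx orbT.
  by rewrite ler_pdivlMr//; lra.
have [Q0 hQ0] := hC _ e0.
apply: (@stable_approximation (2 * beta) Q0.+1) => Q Q0Q.
have [N [N0 NQ QN iso]] := hQ0 Q (ltnW Q0Q).
have N0R : (0 : R) < N%:R by rewrite ltr0n.
have Q0R : (0 : R) < Q%:R by rewrite ltr0n (leq_trans _ Q0Q).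
have [k0 [m0 [k0N km]]] := orbit_dense c0 alphaP x0 N0.
apply: contrapT => nex.
have far k m : (k < N)%N ->
    e / N%:R <= `|m0%:~R - k0%:R * alpha + k%:R * alpha - (m%:~R / 2 - beta)|.
  move=> kN; rewrite leNgt; apply/negP => close; apply: nex.
  exists (k%:Z - k0%:Z), (m - 2 * m0); split; first by clear - kN k0N NQ; lia.
  have -> : 2 * (k%:Z - k0%:Z)%:~R * alpha + 2 * beta - (m - 2 * m0)%:~R =
    2 * (m0%:~R - k0%:R * alpha + k%:R * alpha - (m%:~R / 2 - beta)).
    by rewrite !rmorphB rmorphM/= -!pmulrn; field.
  rewrite normrM ger0_norm// ler_pdivlMr//.
  move: close; rewrite ltr_pdivlMr//; set w := `|_| => close.
  have w0 : 0 <= w by exact: normr_ge0.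
  have : w * Q%:R <= w * (C * N%:R) by rewrite ler_wpM2l.
  have : w * N%:R * C <= e * C by rewrite ler_pM2r// ltW.
  by move: eC; clear; lra.
have [||x [x' [xz x'z]]] := iso k0 (m0%:~R - k0%:R * alpha) k0N.
- by rewrite distrC opprB addrA.
- move=> k d kN [] [m].
    move=> -> /(half_integer_isolated c0 alphaP k0N kN e0 ec e2)[-> ->].
    by rewrite subrK intrM mulrC mulKf.
  move=> /(canRL (addrK _)) ->; have := far k m kN.
  by rewrite leNgt => /negP.
have r2 : e / N%:R <= 2^-1.
  by rewrite (le_trans _ e2)// ler_pdivrMr// ler_peMr ?ler1n// ltW.
have far0 m := far k0 m k0N.
rewrite /f; set r := e / N%:R in xz x'z r2 far0 *.
have xm : m0%:~R - 2^-1 < x + k0%:R * alpha < m0%:~R.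
  by move: xz r2; clear; lra.
have x'm : m0%:~R < x' + k0%:R * alpha < m0%:~R + 2^-1.
  by move: x'z r2; clear; lra.
have -> : phi (x' + k0%:R * alpha + beta) = phi (x + k0%:R * alpha + beta).
  apply: (@phi_locally_constant R (m0%:~R - r + beta) (m0%:~R + r + beta)).
  - move=> _ [m ->] mr; have := far0 m; rewrite subrK leNgt => /negP; apply.
    by rewrite ltr_norml; move: mr; clear; lra.
  - by move: x'z xz; clear; lra.
  - by move: x'z xz; clear; lra.
move=> /addrI /oppr_inj /(can_inj (signedK b)).
exact: phi_jump_at_integer xm x'm.
Qed.

End coboundaries.


(** * The centralizer of a measure preserving map *)

Section centralizer_group.
Context d (X : measurableType d) (R : realType) (mu : {measure set X -> \bar R}).
Implicit Types (S T : X -> X) (P : X -> Prop).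

Lemma ae_preimage S P : measure_preserving mu S ->
  (\forall x \ae mu, P x) -> \forall x \ae mu, P (S x).
Proof.
move=> [mS muS] [N [mN N0 PN]]; exists (S @^-1` N); split.
- by rewrite -[X in measurable X]setTI; exact: mS.
- by rewrite -[LHS]/(pushforward mu S N) muS.
- by move=> x /= nP; apply: PN.
Qed.

Lemma measure_preserving_id : measure_preserving mu idfun.
Proof. by split=> [|A mA]; [exact: measurable_id|]. Qed.

Lemma measure_preserving_comp S T : measure_preserving mu S ->
  measure_preserving mu T -> measure_preserving mu (S \o T).
Proof.
move=> [mS muS] [mT muT]; split; first exact: measurableT_comp.
move=> A mA; rewrite -muS// -[RHS]muT//.
by rewrite -[X in measurable X]setTI; exact: mS.
Qed.

Lemma ae_inverse_comp S S' T T' : measure_preserving mu S -> measure_preserving mu S' ->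
  measure_preserving mu T -> measure_preserving mu T' ->
  ae_inverse mu S S' -> ae_inverse mu T T' -> ae_inverse mu (S \o T) (T' \o S').
Proof.
move=> pS pS' pT pT' [SS' S'S] [TT' T'T]; split.
  by apply: ae_imply (ae_and SS' (ae_preimage pS' TT')) => x [xS xT] /=; rewrite xT.
by apply: ae_imply (ae_and T'T (ae_preimage pT S'S)) => x [xT xS] /=; rewrite xS.
Qed.

Lemma automorphism_id : automorphism mu idfun.
Proof.
split; first exact: measure_preserving_id.
by exists idfun; [exact: measure_preserving_id|split; exact: aeW].
Qed.

Lemma automorphism_comp S T : automorphism mu S -> automorphism mu T ->
  automorphism mu (S \o T).
Proof.
move=> [pS [S' pS' SS']] [pT [T' pT' TT']]; split; first exact: measure_preserving_comp.
by exists (T' \o S'); [exact: measure_preserving_comp|exact: ae_inverse_comp].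
Qed.

Lemma ae_inverse_sym S S' : ae_inverse mu S S' -> ae_inverse mu S' S.
Proof. by move=> []. Qed.

Variable T : X -> X.
Hypothesis pT : measure_preserving mu T.

Lemma centralizer_inverse S S' : centralizer mu T S -> automorphism mu S' ->
  ae_inverse mu S S' -> centralizer mu T S'.
Proof.
move=> [[pS _] ST] autS' [SS' S'S]; split => //.
have [pS' _] := autS'.
have := ae_and (ae_and SS' (ae_preimage pS' ST))
  (ae_preimage (measure_preserving_comp pT pS') S'S).
by apply: ae_imply => x [[SS'x STx]]; rewrite /= STx SS'x.
Qed.

Lemma centralizer_ae_eq S S' : centralizer mu T S -> automorphism mu S' ->
  (\forall x \ae mu, S x = S' x) -> centralizer mu T S'.
Proof.
move=> [_ ST] autS' SS'; split => //.
by apply: ae_imply (ae_and ST (ae_and SS' (ae_preimage pT SS'))) => x [h1 [h2 <-]]; rewrite h1 h2.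
Qed.

Lemma centralizer_comp S S' : centralizer mu T S -> centralizer mu T S' ->
  centralizer mu T (S \o S').
Proof.
move=> [autS ST] [autS' ST']; split; first exact: automorphism_comp.
by apply: ae_imply (ae_and ST' (ae_preimage autS'.1 ST)) => x [h1 h2] /=; rewrite h1 h2.
Qed.

Lemma centralizer_id : centralizer mu T idfun.
Proof. by split; [exact: automorphism_id|exact: aeW]. Qed.

Lemma centralizer_automorphism_group : automorphism_group mu (centralizer mu T).
Proof.
split.
- by move=> S [].
- exact: centralizer_id.
- exact: centralizer_comp.
- exact: centralizer_inverse.
- exact: centralizer_ae_eq.
Qed.

Lemma powers_centralizer : automorphism mu T -> powers mu T `<=` centralizer mu T.
Proof.
move=> autT S [autS [n Sn]].
have Tn : centralizer mu T (iter n T).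
  elim: n {Sn} => [|n IH]; first exact: centralizer_id.
  by apply: (@centralizer_comp T _ _ IH); split => //; exact: aeW.
case: Sn => [Sn|/ae_inverse_sym Sn]; last exact: centralizer_inverse Tn autS Sn.
by apply: centralizer_ae_eq Tn autS _; apply: ae_imply Sn => x ->.
Qed.

End centralizer_group.


(** * The circle as an interval *)

Section circle_lift.
Variable R : realType.
Implicit Types (x t : R) (u a : circle R) (m : int).
Local Notation lambda := (@lebesgue_measure R).
Local Notation proj := (@circle_proj R).

Definition frac x : R := x - (Num.floor x)%:~R.

Lemma frac_itv x : 0 <= frac x < 1.
Proof. by have := floor_itv x; rewrite /frac intrD; lra. Qed.

Lemma frac_id x : 0 <= x < 1 -> frac x = x.
Proof.
move=> x01; rewrite /frac (@floor_def _ x 0) ?subr0//.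
Qed.

Lemma fracDz x m : frac (x + m%:~R) = frac x.
Proof. by rewrite /frac floorDrz ?intr_int// intrKfloor intrD; ring. Qed.

Lemma measurable_frac_preimage (M : set R) : measurable M -> measurable (frac @^-1` M).
Proof.
move=> mM; rewrite (_ : _ @^-1` _ =
    \bigcup_(m : int) (`[m%:~R, m%:~R + 1[%classic `&` (fun x => x + (- m%:~R)) @^-1` M)).
  apply: countable_bigcupT_measurable => // m.
  by apply: measurableI; [exact: measurable_itv|exact: measurable_shift].
apply/seteqP; split => x /=.
  move=> Mx; exists (Num.floor x) => //=; split => //.
  by rewrite in_itv/=; have := floor_itv x; rewrite intrD.
move=> [m _ [/=]]; rewrite in_itv/= => xm; rewrite /frac (@floor_def _ x m)//.
by rewrite intrD.
Qed.

(** The representative in [0, 1[ makes circle-valued maps accessible to real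
    measurability lemmas. *)
Definition circle_lift u : R := frac (repr u).

Lemma circle_lift_itv u : 0 <= circle_lift u < 1.
Proof. exact: frac_itv. Qed.

Lemma circle_proj_frac x : proj (frac x) = proj x.
Proof. by rewrite /frac -mulrNz circle_projDz. Qed.

Lemma circle_liftK : cancel circle_lift proj.
Proof. by move=> u; rewrite /circle_lift circle_proj_frac /circle_proj reprK. Qed.

Lemma circle_lift_proj x : circle_lift (proj x) = frac x.
Proof.
have /circle_projP/intrP[m hm] := circle_liftK (proj x).
rewrite -(fracDz x m) -hm addrC subrK frac_id//; exact: circle_lift_itv.
Qed.

Lemma measurable_proj_preimage (B : set (circle R)) :
  measurable B -> measurable (proj @^-1` B).
Proof. by []. Qed.

Lemma measurable_proj : measurable_fun [set: measurableTypeR R] (proj : _ -> circle R).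
Proof. by move=> _ B mB; rewrite setTI; exact: measurable_proj_preimage. Qed.

Lemma measurable_circle_lift :
  measurable_fun [set: circle R] (circle_lift : _ -> measurableTypeR R).
Proof.
move=> _ M mM; rewrite setTI.
suff : measurable (proj @^-1` (circle_lift @^-1` M)) by [].
rewrite (_ : _ @^-1` _ = frac @^-1` M); first exact: measurable_frac_preimage.
by apply/seteqP; split => x /=; rewrite circle_lift_proj.
Qed.

Lemma proj0 : proj 0 = 0.
Proof. by rewrite /circle_proj !piE. Qed.

Lemma circle_projN x : proj (- x) = - proj x.
Proof. by rewrite /circle_proj !piE. Qed.

Lemma measurable_circle_shift a : measurable_fun [set: circle R] (fun u => u + a : circle R).
Proof.
move=> _ B mB; rewrite setTI.
suff : measurable (proj @^-1` ((fun u => u + a) @^-1` B)) by [].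
rewrite (_ : _ @^-1` _ = (fun x => x + circle_lift a) @^-1` (proj @^-1` B)).
  by apply: measurable_shift; exact: mB.
by apply/seteqP; split => x /=; rewrite circle_projD circle_liftK.
Qed.

(** With t the representative of a, the part of the translated set over [1, t + 1[
    is brought back to [0, t[ by periodicity. *)
Lemma circle_measure_shift a (B : set (circle R)) : measurable B ->
  circle_measure ((fun u => u + a) @^-1` B) = circle_measure B.
Proof.
move=> mB; have /andP[t0 t1] := circle_lift_itv a; set t := circle_lift a in t0 t1.
pose W := proj @^-1` B; have mW : measurable W by exact: measurable_proj_preimage.
have split_itv (p q r : R) : p <= q -> q <= r ->
    lambda (W `&` `[p, r[) = (lambda (W `&` `[p, q[) + lambda (W `&` `[q, r[))%E.
  move=> pq qr.
  have -> : W `&` `[p, r[ = (W `&` `[p, q[) `|` (W `&` `[q, r[).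
    rewrite -setIUr; congr setI; apply/seteqP; split => x /=; rewrite !in_itv/=.
      by move=> h; case: (ltP x q) => ?; [left|right]; lra.
    by case; lra.
  apply: measureU.
  - by apply: measurableI => //; exact: measurable_itv.
  - by apply: measurableI => //; exact: measurable_itv.
  - by apply/seteqP; split => // x /= [[_ +] [_]]; rewrite !in_itv/=; lra.
rewrite /circle_measure.
have -> : proj @^-1` ((fun u => u + a) @^-1` B) `&` `[0, 1[ =
    (fun x => x + t) @^-1` (W `&` `[t, t + 1[).
  apply/seteqP; split => x /=; rewrite /W /= !in_itv/= circle_projD circle_liftK => -[Bx x01];
    (split; first exact: Bx); move: x01 t0 t1; clear; lra.
rewrite lebesgue_measure_shift; last by apply: measurableI => //; exact: measurable_itv.
have t2 : 1 <= t + 1 by rewrite lerDr.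
rewrite (split_itv t 1 (t + 1) (ltW t1) t2) (split_itv 0 t 1 t0 (ltW t1)).
rewrite addeC; congr (_ + _)%E.
rewrite -(@lebesgue_measure_shift R 1 (W `&` `[1, t + 1[)); last first.
  by apply: measurableI => //; exact: measurable_itv.
apply: congr1; apply/seteqP; split => x /=; rewrite /W /= !in_itv/=;
  rewrite (circle_projDz x 1) => -[Bx x01];
  (split; first exact: Bx); move: x01 t0 t1; clear; lra.
Qed.

Lemma ae_circle (P : circle R -> Prop) :
  (\forall u \ae (@circle_measure R), P u) <-> (\forall x \ae lambda, P (proj x)).
Proof.
split=> [[N [mN N0 PN]]|[M [mM M0 PM]]].
  have N0' : \forall x \ae lambda, forall m : int, ~ (N (proj x) /\ 0 <= x + m%:~R < 1).
    apply: ae_forall_countable => m.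
    have mNI : measurable (proj @^-1` N `&` `[0, 1[).
      apply: measurableI; last exact: measurable_itv.
      exact: (@measurable_proj_preimage N mN).
    exists ((fun x => x + m%:~R) @^-1` (proj @^-1` N `&` `[0, 1[)); split.
    - exact: measurable_shift.
    - exact: (etrans (lebesgue_measure_shift _ mNI) N0).
    - move=> x /= nn; apply: contrapT => nNx; apply: nn => -[Nx x01]; apply: nNx.
      by rewrite in_itv/= circle_projDz.
  apply: ae_imply N0' => x xN; apply: contrapT => nP.
  apply: (xN (- Num.floor x)); split; first exact: PN.
  by rewrite mulrNz; exact: frac_itv.
exists (circle_lift @^-1` M); split.
- by rewrite -[X in measurable X]setTI; exact: measurable_circle_lift.
- apply/eqP; rewrite -measure_le0 -[leRHS]M0.
  apply: le_measure; rewrite ?inE//.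
    apply: measurableI; last exact: measurable_itv.
    apply: (@measurable_proj_preimage (circle_lift @^-1` M)).
    by rewrite -[X in measurable X]setTI; exact: measurable_circle_lift.
  by move=> x [/=]; rewrite circle_lift_proj in_itv/= => + x01; rewrite frac_id.
- by move=> u /= nP; apply: PM => /=; rewrite circle_liftK.
Qed.

End circle_lift.


(** * Skew products over rotations *)

Section skew_products.
Variable R : realType.
Implicit Types (x t : R) (u a : circle R) (b : bool) (g : circle R -> halfZ R) (m : int).
Local Notation lambda := (@lebesgue_measure R).
Local Notation proj := (@circle_proj R).
Local Notation mu := (@cylinder_measure R).

Lemma counting_preimage (h h' : halfZ R -> halfZ R) (A : set (halfZ R)) :
  cancel h h' -> cancel h' h -> @halfZ_counting R (h @^-1` A) = @halfZ_counting R A.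
Proof.
move=> hK h'K; have imE : h @` (h @^-1` A) = A.
  apply/seteqP; split => [_ [y Ay <-]//|y Ay]; exists (h' y) => /=; by rewrite h'K.
rewrite /halfZ_counting /counting.
have [finA|infA] := pselect (finite_set A).
  have finhA : finite_set (h @^-1` A).
    by apply: finite_preimage => // x y _ _; exact: (can_inj hK).
  rewrite !asboolT//; congr (_%:R%:E).
  rewrite -[in RHS]imE fset_set_image// finmap.card_imfset//=.
  exact: (can_inj hK).
rewrite !asboolF// => finhA; apply: infA; rewrite -imE; exact: finite_image.
Qed.

(** T, the fiber translations and the half-turn flip are of this form. *)
Definition skew a b g (z : cylinder R) : cylinder R := (z.1 + a, signed b z.2 + g z.1).

Lemma measurable_skew a b g : measurable_fun [set: circle R] g ->
  measurable_fun [set: cylinder R] (skew a b g).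
Proof.
move=> mg; apply/measurable_fun_pairP; split.
  by apply: (measurableT_comp (measurable_circle_shift a)); exact: measurable_fst.
move=> _ Y _; rewrite setTI.
rewrite (_ : _ @^-1` Y = \bigcup_(k : int)
    ((g @^-1` [set v | Y (signed b (halfz R k) + v)]) `*` [set halfz R k])); last first.
  apply/seteqP; split => [[u y]/= Yz|[u y] [k _ [/= Yv ->]]//].
  by exists (Num.floor (2 * (y : R))) => //=; rewrite -halfz_surj.
apply: countable_bigcupT_measurable => // k; apply: measurableX => //.
by rewrite -[X in measurable X]setTI; exact: mg.
Qed.

Lemma measure_preserving_skew a b g : measurable_fun [set: circle R] g ->
  measure_preserving mu (skew a b g).
Proof.
move=> mg; split; first exact: measurable_skew.
move=> A mA; rewrite /pushforward /=.
pose F u := @halfZ_counting R (xsection A u).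
have mF : measurable_fun [set: circle R] F.
  exact: (measurable_fun_xsection (@halfZ_counting R)).
rewrite /cylinder_measure /= /product_measure1.
transitivity (\int[@circle_measure R]_u F (u + a)%R)%E.
  apply: eq_integral => u _ /=; rewrite /F.
  rewrite -[RHS](@counting_preimage (fun y => signed b y + g u) (fun y => signed b (y - g u))).
  - by congr halfZ_counting; apply/seteqP; split => y /=; rewrite /xsection/= !inE.
  - by move=> y; rewrite addrK signedK.
  - by move=> y; rewrite signedK subrK.
pose s u : circle R := u + a.
have ms : measurable_fun setT s by exact: measurable_circle_shift.
transitivity (\int[pushforward (@circle_measure R) s]_u F u)%E.
  by rewrite (ge0_integral_pushforward ms).
apply: eq_measure_integral => B mB _.
exact: circle_measure_shift.
Qed.

Lemma skewK a b g : cancel (skew a b g) (skew (- a) b (fun u => - signed b (g (u - a)))).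
Proof.
by move=> [u y]; rewrite /skew /= signedD signedK !addrK.
Qed.

Lemma skewKV a b g : cancel (skew (- a) b (fun u => - signed b (g (u - a)))) (skew a b g).
Proof.
move=> [u y]; rewrite /skew /= subrK signedD signedK.
have -> : signed b (- signed b (g (u - a))) = - g (u - a).
  by rewrite /signed; case: b; rewrite ?opprK.
by rewrite subrK.
Qed.

Lemma automorphism_skew a b g : measurable_fun [set: circle R] g ->
  automorphism mu (skew a b g).
Proof.
move=> mg; split; first exact: measure_preserving_skew.
exists (skew (- a) b (fun u => - signed b (g (u - a)))).
  apply: measure_preserving_skew => _ Y _; rewrite setTI.
  rewrite (_ : _ @^-1` Y = (fun u => u - a) @^-1` (g @^-1` [set v | Y (- signed b v)]))//.
  rewrite -[X in measurable X]setTI; apply: measurable_circle_shift => //.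
  by rewrite -[X in measurable X]setTI; exact: mg.
by split; apply: aeW => z; rewrite ?skewK ?skewKV.
Qed.

(** The fiber is countable with atoms of mass 1, so a null set of the cylinder is
    one whose horizontal sections are all null. *)
Lemma ae_cylinder (P : cylinder R -> Prop) :
  (\forall z \ae mu, P z) <-> (\forall x \ae lambda, forall y, P (proj x, y)).
Proof.
split=> [[N [mN N0 PN]]|aeP].
  have : \forall u \ae (@circle_measure R), forall k : int, ~ N (u, halfz R k).
    apply: ae_forall_countable => k; exists (ysection N (halfz R k)); split.
    - exact: measurable_ysection.
    - have mY : measurable (ysection N (halfz R k)) by exact: measurable_ysection.
      have : (mu (ysection N (halfz R k) `*` [set halfz R k]) <= mu N)%E.
        apply: le_measure; rewrite ?inE//; first exact: measurableX.
        by move=> [u y] [/= + ->]; rewrite /ysection/= inE.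
      have -> : mu (ysection N (halfz R k) `*` [set halfz R k]) =
          (circle_measure (ysection N (halfz R k)) * @halfZ_counting R [set halfz R k])%E.
        exact: product_measure1E.
      have -> : @halfZ_counting R [set halfz R k] = 1%E.
        by rewrite /halfZ_counting /counting asboolT// fset_set1 finmap.cardfs1.
      by rewrite N0 mule1 => h; apply/eqP; rewrite -measure_le0.
    - move=> u /= nn; apply: contrapT => nN; apply: nn => Nu; apply: nN.
      by rewrite /ysection/= inE.
  move/ae_circle; apply: ae_imply => x xN y; apply: contrapT => nP.
  by apply: (xN (Num.floor (2 * (y : R)))); rewrite -halfz_surj; exact: PN.
have [M [mM M0 PM]] := (ae_circle (fun u => forall y, P (u, y))).2 aeP.
exists (M `*` setT); split.
- exact: measurableX.
- have -> : mu (M `*` setT) = (circle_measure M * @halfZ_counting R setT)%E.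
    exact: product_measure1E.
  by rewrite M0 mul0e.
- by move=> [u y] /= nP; split => //; apply: PM => /= h; exact: nP.
Qed.

Lemma measurable_phi_half : measurable_fun [set: circle R] (@phi_half R).
Proof.
move=> _ Y _; rewrite setTI.
suff : measurable [set x : R | Y (phi x)] by [].
have -> : [set x : R | Y (phi x)] =
    ([set x | Y (halfz R 1)] `&` @frac R @^-1` `[0, 2^-1]) `|`
    ([set x | Y (halfz R (-1))] `&` ~` (@frac R @^-1` `[0, 2^-1])).
  have phix x : phi x = halfz R (if frac x <= 2^-1 then 1 else -1).
    have x01 : 0%:~R <= frac x < 0%:~R + 1 by rewrite add0r; exact: frac_itv.
    by have := phiE x01; rewrite add0r /phi circle_proj_frac.
  apply/seteqP; split => x /=; rewrite phix in_itv/=; have /andP[-> _] := frac_itv x.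
    by case: ifP => _ h /=; [left|right].
  by case: ifP => _ /= [[]|[]].
have mcst (Q : Prop) : measurable [set x : R | Q].
  have [q|nq] := pselect Q.
    by rewrite (_ : [set x | Q] = setT)//; apply/seteqP; split.
  by rewrite (_ : [set x | Q] = set0)//; apply/seteqP; split.
have mfrac : measurable (@frac R @^-1` `[0 : R, 2^-1]).
  by apply: measurable_frac_preimage; exact: measurable_itv.
by apply: measurableU; apply: measurableI => //; exact: measurableC.
Qed.

End skew_products.


(** * Maps commuting with the cylinder map *)

Lemma iter_cancel (X : Type) (f g : X -> X) n : cancel f g -> cancel (iter n f) (iter n g).
Proof. by move=> fK x; elim: n => //= n IH; rewrite -iterS iterSr fK. Qed.

Section centralizer_elements.
Variables (R : realType) (alpha c : R).
Hypotheses (c0 : 0 < c) (alphaP : badly_approximable c alpha).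
Implicit Types (x t : R) (y v : halfZ R) (b : bool) (m j k : int).
Local Notation lambda := (@lebesgue_measure R).
Local Notation proj := (@circle_proj R).
Local Notation mu := (@cylinder_measure R).

(** The sets E i separate the points of U; ergodicity decides each of them, and the
    decisions determine the value. *)
Lemma ergodic_constant (U : Type) (I : countType) (E : I -> set U) (F : R -> halfZ R -> U) :
  (forall u u', (forall i, E i u <-> E i u') -> u = u') ->
  (forall i y, measurable [set x | E i (F x y)]) ->
  (forall x m y, F (x + m%:~R) y = F x y) ->
  (\forall x \ae lambda, forall y, F (x + alpha) (y + phi x) = F x y) ->
  exists u, \forall x \ae lambda, forall y, F x y = u.
Proof.
move=> sep mF Fz Finv.
have /choice[P PE] : forall i, exists P : Prop, \forall x \ae lambda,
    forall y, E i (F x y) <-> P.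
  move=> i; have := @cylinder_ergodic R alpha c c0 alphaP (fun x y => E i (F x y)) (mF i).
  case.
  - by move=> x m y; rewrite Fz.
  - by apply: ae_imply Finv => x Fx y; rewrite Fx.
  - by move=> h; exists True; apply: ae_imply h => x Ex y.
  - by move=> h; exists False; apply: ae_imply h => x Ex y; split => // /Ex.
have {}PE : \forall x \ae lambda, forall i y, E i (F x y) <-> P i.
  by apply: ae_forall_countable.
have [x0 x0E] := ae_exists PE; exists (F x0 0).
by apply: ae_imply PE => x xE y; apply: sep => i; rewrite xE x0E.
Qed.

Lemma additive_halfz (w : int -> halfZ R) : (forall j k, w (j + k) = w j + w k) ->
  exists e : int, forall j, w j = halfz R (e * j).
Proof.
move=> wD; exists (Num.floor (2 * (w 1 : R))) => j; set e := Num.floor _.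
have w1 : w 1 = halfz R e by exact: halfz_surj.
have w0 : w 0 = 0.
  have := wD 0 0; rewrite addr0 => /(congr1 (fun u => u - w 0)).
  by rewrite subrr addrK.
have wn (n : nat) : w n%:Z = halfz R (e * n%:Z).
  elim: n => [|n IH]; first by rewrite mulr0 halfz0.
  by rewrite intS wD IH w1 mulrDr mulr1 halfzD.
have [j0|j0] := leP 0 j; first by rewrite -(gez0_abs j0) wn.
apply: (@addIr _ (w (- j))); rewrite -wD addrN w0.
by rewrite -(ltz0_abs j0) wn -halfzD ltz0_abs// -mulrDr subrr mulr0 halfz0.
Qed.

Let T := cylinder_map alpha (@phi_half R).

(** The rotation angle is obtained as the constant value of S (x, y) - x, read in
    [0, 1[ and tested against the rationals; then the constants w j are the
    variations of the fiber coordinate when y increases by j / 2. *)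
Lemma commuting_form (S : cylinder R -> cylinder R) :
  measurable_fun [set: cylinder R] S -> (\forall z \ae mu, S (T z) = T (S z)) ->
  exists beta (e : int) (psi : R -> halfZ R),
    [/\ forall y, measurable [set x | psi x = y], forall x m, psi (x + m%:~R) = psi x &
      \forall x \ae lambda, forall k,
        S (proj x, halfz R k) = (proj (x + beta), psi x + halfz R (e * k))].
Proof.
move=> mS /ae_cylinder ST.
have {}ST : \forall x \ae lambda, forall y,
    S (proj (x + alpha), y + phi x) = T (S (proj x, y)).
  by apply: ae_imply ST => x xST y; rewrite -xST /T /cylinder_map /= circle_projD.
have mSy y : measurable_fun [set: measurableTypeR R] (fun x => S (proj x, y)).
  apply: (measurableT_comp mS); apply/measurable_fun_pair; first exact: measurable_proj.
  exact: measurable_cst.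
have mS1 y : measurable_fun [set: measurableTypeR R] (fun x => (S (proj x, y)).1).
  exact: (measurableT_comp measurable_fst (mSy y)).
have mS2 y : measurable_fun [set: measurableTypeR R] (fun x => (S (proj x, y)).2).
  exact: (measurableT_comp measurable_snd (mSy y)).
have [beta betaP] : exists beta, \forall x \ae lambda, forall y,
    (S (proj x, y)).1 = proj (x + beta).
  pose F x y := circle_lift ((S (proj x, y)).1 - proj x).
  have [t tP] : exists t, \forall x \ae lambda, forall y, F x y = t.
    apply: (@ergodic_constant _ rat (fun q => [set s | s < ratr q])).
    - move=> u v uv; apply/eqP; rewrite eq_le !leNgt; apply/andP; split; apply/negP => lt_uv.
        have [q] := rat_in_itvoo lt_uv; rewrite in_itv/= => /andP[vq qu].
        by move: ((uv q).2 vq) => /= uq; have := lt_trans uq qu; rewrite ltxx.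
      have [q] := rat_in_itvoo lt_uv; rewrite in_itv/= => /andP[uq qv].
      by move: ((uv q).1 uq) => /= vq; have := lt_trans vq qv; rewrite ltxx.
    - move=> q y; pose h x := circle_lift (S (proj x, y)).1 - x.
      have mh : measurable_fun [set: measurableTypeR R] (h : _ -> measurableTypeR R).
        apply: measurable_funB => //.
        exact: (measurableT_comp (@measurable_circle_lift R) (mS1 y)).
      rewrite (_ : [set x | _] = h @^-1` (@frac R @^-1` `]-oo, ratr q[)).
        rewrite -[X in measurable X]setTI; apply: mh => //.
        by apply: measurable_frac_preimage; exact: measurable_itv.
      apply/seteqP; split => x /=;
        by rewrite in_itv/= /F /h -circle_lift_proj circle_projD circle_projN circle_liftK.
    - by move=> x m y; rewrite /F circle_projDz.
    - apply: ae_imply ST => x xST y; rewrite /F xST /T /cylinder_map /= circle_projD.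
      by rewrite opprD addrACA subrr addr0.
  exists t; apply: ae_imply tP => x xt y.
  by rewrite circle_projD -(xt y) /F circle_liftK addrC subrK.
have [w wP] : exists w : int -> halfZ R, \forall x \ae lambda, forall j y,
    (S (proj x, y + halfz R j)).2 = (S (proj x, y)).2 + w j.
  pose F j x y := (S (proj x, y + halfz R j)).2 - (S (proj x, y)).2.
  have /choice[w wP] : forall j, exists w, \forall x \ae lambda, forall y, F j x y = w.
    move=> j; apply: (@ergodic_constant _ int (fun k => [set v | v = halfz R k])).
    - move=> u v uv; have := (uv (Num.floor (2 * (u : R)))).1; rewrite -halfz_surj /=.
      by move=> /(_ erefl) ->.
    - move=> k y; rewrite (_ : [set x | _] = \bigcup_(l : int)
          ((fun x => (S (proj x, y)).2) @^-1` [set halfz R l] `&`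
           (fun x => (S (proj x, y + halfz R j)).2) @^-1` [set halfz R (k + l)])).
        apply: countable_bigcupT_measurable => // l.
        apply: measurableI; rewrite -[X in measurable X]setTI.
          exact: (mS2 y).
        exact: (mS2 (y + halfz R j)).
      apply/seteqP; split => x /=; rewrite /F.
        set s := (S (proj x, y)).2 => h; exists (Num.floor (2 * (s : R))) => //=.
        by rewrite halfzD -halfz_surj -h subrK.
      by move=> [l _ [/= -> ->]]; rewrite halfzD addrK.
    - by move=> x m y; rewrite /F circle_projDz.
    - apply: ae_imply (ae_and ST betaP) => x [xST xb] y.
      rewrite /F addrAC !xST /T /cylinder_map /= !xb.
      by rewrite opprD addrACA subrr addr0.
  have {}wP : \forall x \ae lambda, forall j y, F j x y = w j by exact: ae_forall_countable.
  by exists w; apply: ae_imply wP => x xw j y; rewrite [RHS]addrC -(xw j y) subrK.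
have [x0 wx0] := ae_exists wP.
have [e eP] : exists e : int, forall j, w j = halfz R (e * j).
  apply: additive_halfz => j k; apply: (@addrI _ (S (proj x0, 0)).2).
  by rewrite -wx0 addrA -!wx0 halfzD addrA.
exists beta, e, (fun x => (S (proj x, 0)).2); split.
- by move=> y; have := mS2 0 measurableT [set y] I; rewrite setTI.
- by move=> x m; rewrite circle_projDz.
- apply: ae_imply (ae_and betaP wP) => x [xb xw] k.
  by rewrite -eP -xw add0r -(xb (halfz R k)); case: (S _).
Qed.

(** The inverse of S also commutes with T, hence has the form given by
    commuting_form with an integer e', and comparing the heights 0 and 1/2 in
    S' (S z) = z gives e' e = 1. The cohomological equation is then the fiber
    coordinate of S (T (x, 0)) = T (S (x, 0)). *)
Lemma centralizer_form (S : cylinder R -> cylinder R) : centralizer mu T S ->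
  exists beta b (psi : R -> halfZ R),
    [/\ forall y, measurable [set x | psi x = y], forall x m, psi (x + m%:~R) = psi x,
      \forall x \ae lambda, forall y, S (proj x, y) = (proj (x + beta), psi x + signed b y) &
      \forall x \ae lambda, psi (x + alpha) = psi x + (phi (x + beta) - signed b (phi x))].
Proof.
move=> CS; have [[[mS _] [S' [mS' muS'] SS']] ST] := CS.
have autS' : automorphism mu S'.
  by split => //; exists S; [case: CS => -[]|exact: ae_inverse_sym].
have pT : measure_preserving mu T.
  rewrite (_ : T = skew (proj alpha) false (@phi_half R)).
    by apply: measure_preserving_skew; exact: (@measurable_phi_half R).
  by apply/funext.
have [_ S'T] := centralizer_inverse pT CS autS' SS'.
have [beta [e [psi [mpsi psiz Spsi]]]] := commuting_form mS ST.
have [beta' [e' [psi' [_ _ Spsi']]]] := commuting_form mS' S'T.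
have ee' : e' * e = 1.
  have [_ /ae_cylinder S'S] := SS'.
  have [x [[xS xS'] xSS']] := ae_exists (ae_and (ae_and Spsi (ae_shift beta Spsi')) S'S).
  pose p := Num.floor (2 * (psi x : R)).
  have comp k : psi' (x + beta) = halfz R (k - e' * (p + e * k)).
    have := xSS' (halfz R k); rewrite xS (halfz_surj (psi x)) -/p -halfzD xS'.
    by move=> /(congr1 snd)/= h; rewrite halfzD halfzN -h addrK.
  have := comp 1; rewrite (comp 0) => /halfz_inj.
  by rewrite mulr0 mulr1 mulrDr => h; clear - h; lia.
have [b eb] : exists b, forall y, signed b y = halfz R (e * Num.floor (2 * (y : R))).
  have [e1|e1] : e = 1 \/ e = -1.
    have : (absz e' * absz e = 1)%N by rewrite -abszM ee'.
    by move=> /eqP; rewrite muln_eq1 => /andP[_ /eqP]; clear; lia.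
  - by exists false => y; rewrite e1 mul1r -halfz_surj.
  - by exists true => y; rewrite e1 mulN1r halfzN -halfz_surj.
have formS : \forall x \ae lambda, forall y, S (proj x, y) = (proj (x + beta), psi x + signed b y).
  by apply: ae_imply Spsi => x xS y; rewrite eb -xS -halfz_surj.
exists beta, b, psi; split => //.
move/ae_cylinder : ST => ST.
apply: ae_imply (ae_and ST (ae_and formS (ae_shift alpha formS))) => x [xST [xS xS']].
have := xST 0; rewrite /T /cylinder_map /= xS /= -circle_projD add0r -/(phi x) xS'.
rewrite -/(phi (x + beta)) => /(congr1 snd)/=.
have -> : signed b (0 : halfZ R) = 0 by rewrite /signed; case: (b); rewrite ?oppr0.
by rewrite addr0 addrA => <-; rewrite addrK.
Qed.


Let skewT : T = skew (proj alpha) false (@phi_half R).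
Proof. by apply/funext. Qed.

Lemma automorphism_cylinder_map : automorphism mu T.
Proof. by rewrite skewT; apply: automorphism_skew; exact: (@measurable_phi_half R). Qed.

Let pT : measure_preserving mu T := automorphism_cylinder_map.1.

(** Negative powers are provided as iterates of an inverse of T defined everywhere,
    so that the cancellation holds at every point. *)
Lemma integer_power (l : int) : exists P P', [/\ powers mu T P, powers mu T P',
  cancel P' P & forall z, (P z).1 = z.1 + proj (l%:~R * alpha)].
Proof.
pose Tinv := skew (- proj alpha) false (fun u => - signed false (@phi_half R (u - proj alpha))).
have TK : cancel T Tinv by rewrite skewT; exact: skewK.
have TinvK : cancel Tinv T by rewrite skewT; exact: skewKV.
have autTinv : automorphism mu Tinv.
  apply: automorphism_skew => _ Y _; rewrite setTI.
  rewrite (_ : _ @^-1` Y = (fun u => u - proj alpha) @^-1` (@phi_half R @^-1` [set v | Y (- v)]))//.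
  rewrite -[X in measurable X]setTI; apply: measurable_circle_shift => //.
  by rewrite -[X in measurable X]setTI; exact: (@measurable_phi_half R).
have aut_iter (V : cylinder R -> cylinder R) n : automorphism mu V -> automorphism mu (iter n V).
  move=> autV; elim: n => [|n IH]; first exact: automorphism_id.
  exact: (automorphism_comp autV IH).
have powT n : powers mu T (iter n T).
  by split; [exact/aut_iter/automorphism_cylinder_map|exists n; left; exact: aeW].
have powTinv n : powers mu T (iter n Tinv).
  split; first exact: aut_iter.
  exists n; right; split; apply: aeW => z; first exact: (iter_cancel _ TK).
  exact: (iter_cancel _ TinvK).
have iterT n z : (iter n T z).1 = z.1 + proj (n%:R * alpha).
  elim: n => [|n IH]; first by rewrite mul0r proj0 addr0.
  by rewrite iterS /T /= IH -natr1 mulrDl mul1r circle_projD addrA.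
case: l => n; [exists (iter n T), (iter n Tinv)|
  exists (iter n.+1 Tinv), (iter n.+1 T)]; split => //.
- exact: (iter_cancel _ TinvK).
- exact: (iter_cancel _ TK).
- move=> z; apply: (@addIr _ (proj (n.+1%:R * alpha))).
  rewrite -iterT (iter_cancel _ TinvK) -addrA -circle_projD NegzE mulrNz mulNr.
  by rewrite -pmulrn addNr proj0 addr0.
Qed.

Lemma half_turnK : involutive (@half_turn_flip R).
Proof.
move=> [u y]; rewrite /half_turn_flip /= opprK -addrA -circle_projD.
have -> : (2^-1 + 2^-1 : R) = 0 + 1%:~R by rewrite rmorph1; field.
by rewrite circle_projDz proj0 addr0.
Qed.

(** Commutation is checked off the half-integers, where phi (x + 1/2) = - phi x
    may fail. *)
Lemma half_turn_centralizer : centralizer mu T (@half_turn_flip R).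
Proof.
have -> : @half_turn_flip R = skew (proj 2^-1) true (fun=> 0).
  by apply/funext => z; rewrite /half_turn_flip /skew /= addr0.
split; first by apply: automorphism_skew; exact: measurable_cst.
apply/ae_cylinder.
have : \forall x \ae lambda, forall m, x <> m%:~R / 2.
  apply: ae_forall_countable => m; exists [set m%:~R / 2]; split => //.
  - exact: lebesgue_measure_set1.
  - by move=> x /= /contrapT.
apply: ae_imply => x xm y; rewrite /T /cylinder_map /skew /= !addr0.
congr (_, _); first by rewrite addrAC.
rewrite -circle_projD -/(phi (x + 2^-1)) phi_half_turn; last by move=> [m xE]; exact: (xm m xE).
by rewrite opprD.
Qed.

Lemma fiber_translation_centralizer v : centralizer mu T (fiber_translation v).
Proof.
have vE : fiber_translation v = skew 0 false (fun=> v).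
  by apply/funext => z; rewrite /fiber_translation /skew /= addr0.
split; first by rewrite vE; apply: automorphism_skew; exact: measurable_cst.
by apply: aeW => z; rewrite /fiber_translation /T /cylinder_map /= addrAC.
Qed.


(** If the sign were -1, phi + phi would be a coboundary. *)
Lemma centralizer_trivial_base S : centralizer mu T S ->
  (\forall x \ae lambda, forall y, (S (proj x, y)).1 = proj x) ->
  exists v, \forall z \ae mu, S z = fiber_translation v z.
Proof.
move=> CS base; have [t [b [psi [mpsi psiz formS psiT]]]] := centralizer_form CS.
have pt : proj t = 0.
  have [x [xb xS]] := ae_exists (ae_and base formS).
  have := xb 0; rewrite xS /= circle_projD => /(congr1 (fun u => u - proj x)).
  by rewrite addrAC subrr add0r.
have phit x : phi (x + t) = phi x by rewrite /phi circle_projD pt addr0.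
case: b formS psiT => formS psiT.
  exfalso; apply: (double_phi_not_coboundary c0 alphaP mpsi psiz).
  by apply: ae_imply psiT => x ->; rewrite phit /signed opprK.
have [v vP] : exists v, \forall x \ae lambda, forall y : halfZ R, psi x = v.
  apply: (@ergodic_constant _ int (fun k => [set v | v = halfz R k]) (fun x _ => psi x)).
  - move=> u v uv; have := (uv (Num.floor (2 * (u : R)))).1; rewrite -halfz_surj /=.
    by move=> /(_ erefl) ->.
  - by move=> k _; exact: mpsi.
  - by move=> x m _; rewrite psiz.
  - by apply: ae_imply psiT => x -> _; rewrite phit /signed subrr addr0.
exists v; apply/ae_cylinder; apply: ae_imply (ae_and formS vP) => x [xS xv] y.
by rewrite xS (xv y) circle_projD pt addr0 /fiber_translation /signed addrC.
Qed.

Theorem centralizer_generated :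
  centralizer mu T = generated_group mu
    (range (@fiber_translation R) `|` [set @half_turn_flip R] `|` powers mu T).
Proof.
have pow_cent := @powers_centralizer _ _ _ mu T pT automorphism_cylinder_map.
apply/seteqP; split; last first.
  apply: smallest_sub; first exact: centralizer_automorphism_group.
  move=> S [[[v _ <-]|->]|]; [exact: fiber_translation_centralizer|
    exact: half_turn_centralizer|exact: pow_cent].
move=> S CS H [grpH genH].
have [_ _ H_comp _ H_ae] := grpH.
have [beta [b [psi [mpsi psiz formS psiT]]]] := centralizer_form CS.
have [l [n ln]] := phi_translate_coboundary c0 alphaP mpsi psiz psiT.
have [P [P' [powP powP' P'K P1]]] := integer_power l.
(* F is the flip or the identity, according to the parity of n = 2 l alpha + 2 beta,
   so that S o P o F acts trivially on the base. *)
have [F [CF HF FK [r [F1 rn]]]] : exists F, [/\ centralizer mu T F, H F, involutive F &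
    exists r : R, (forall z, (F z).1 = z.1 + proj r) /\ exists h : int, r + n%:~R / 2 = h%:~R].
  have [h [->|->]] := int_parity n.
    exists idfun; split => //.
    - exact: centralizer_id.
    - by have [] := grpH.
    - by exists 0; split => [z|]; [rewrite proj0 addr0|exists h; rewrite intrM; field].
  exists (@half_turn_flip R); split.
  - exact: half_turn_centralizer.
  - by apply: genH; left; right.
  - exact: half_turnK.
  - by exists 2^-1; split => //; exists (h + 1); rewrite !rmorphD rmorphM/=; field.
pose S0 := S \o (P \o F).
have CS0 : centralizer mu T S0.
  apply: centralizer_comp => //; apply: centralizer_comp => //; exact: pow_cent.
have base : \forall x \ae lambda, forall y, (S0 (proj x, y)).1 = proj x.
  have := ae_shift (r + l%:~R * alpha) formS; apply: ae_imply => x xS y.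
  rewrite /S0 /=; have := P1 (F (proj x, y)); rewrite F1 /= -addrA -circle_projD -circle_projD.
  case: (P _) => u v /= ->; rewrite xS /=; case: rn => h hE.
  have -> : x + (r + l%:~R * alpha) + beta = x + h%:~R.
    by rewrite -hE -ln; field.
  exact: circle_projDz.
have [v vP] := centralizer_trivial_base CS0 base.
have HS0 : H S0.
  apply: (H_ae (fiber_translation v)); first by apply: genH; left; left; exists v.
    by have [] := CS0.
  by apply: ae_imply vP => z ->.
have -> : S = S0 \o (F \o P').
  by apply/funext => z; rewrite /S0 /= FK P'K.
by apply: (H_comp _ _ HS0); apply: H_comp HF _; apply: genH; right.
Qed.

End centralizer_elements.

Unset Implicit Arguments.
Set Strict Implicit.

Theorem theorem3p4 (R : realType) (alpha : R)
    (alpha01 : 0 < alpha < 1) (alpha_bounded : bounded_type alpha) :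
  let T := cylinder_map alpha (@phi_half R) in
  centralizer (@cylinder_measure R) T =
  generated_group (@cylinder_measure R)
    (range (@fiber_translation R) `|` [set @half_turn_flip R]
      `|` powers (@cylinder_measure R) T).
Proof.
have [c c0 alphaP] := bounded_type_badly_approximable alpha01 alpha_bounded.
exact: centralizer_generated c0 alphaP.
Qed.
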